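(* There is no quartic number field $K$ such that the number of elliptic curves $E$ over $K$ with $\mathbb{Z}/6\mathbb{Z}\oplus\mathbb{Z}/6\mathbb{Z}$ isomorphic to a subgroup of $E(K)$ is positive and finite.
   Context: Elliptic curves are counted up to isomorphism over $\overline{K}$. *)

(* Defs.v *)
From HB Require Import structures.
From mathcomp Require Import all_boot all_order all_algebra all_field.
From mathcomp Require Import ring.
From mathcomp Require Import boolp classical_sets functions cardinality.

Set Implicit Arguments.
Unset Strict Implicit.
Unset Printing Implicit Defensive.

Import GRing.Theory.
Local Open Scope ring_scope.

(* y^2 + a1 x y + a3 y = x^3 + a2 x^2 + a4 x + a6 *)
Record weierstrass (R : Type) : Type :=
  Weierstrass { wa1 : R; wa2 : R; wa3 : R; wa4 : R; wa6 : R }.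

Definition map_weierstrass (R S : Type) (f : R -> S) (W : weierstrass R) :
    weierstrass S :=
  Weierstrass (f (wa1 W)) (f (wa2 W)) (f (wa3 W)) (f (wa4 W)) (f (wa6 W)).

Definition weval (F : fieldType) (W : weierstrass F) (x y : F) : F :=
  y ^+ 2 + wa1 W * x * y + wa3 W * y
  - (x ^+ 3 + wa2 W * x ^+ 2 + wa4 W * x + wa6 W).

Definition wdisc (F : fieldType) (W : weierstrass F) : F :=
  let a1 := wa1 W in let a2 := wa2 W in let a3 := wa3 W in
  let a4 := wa4 W in let a6 := wa6 W in
  let b2 := a1 ^+ 2 + 4%:R * a2 in
  let b4 := 2%:R * a4 + a1 * a3 in
  let b6 := a3 ^+ 2 + 4%:R * a6 in
  let b8 := a1 ^+ 2 * a6 + 4%:R * a2 * a6 - a1 * a3 * a4 + a2 * a3 ^+ 2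
            - a4 ^+ 2 in
  - b2 ^+ 2 * b8 - 8%:R * b4 ^+ 3 - 27%:R * b6 ^+ 2 + 9%:R * b2 * b4 * b6.

Record elliptic_curve (F : fieldType) : Type :=
  EllipticCurve { model :> weierstrass F; _ : wdisc model != 0 }.

(* [None] is the point at infinity; [Some (x, y)] is an affine point. *)
Definition on_curve (F : fieldType) (W : weierstrass F) (P : option (F * F)) :
    bool :=
  if P is Some (x, y) then weval W x y == 0 else true.

(* The chord-tangent law.  The first test says that the second point is the
   opposite (x1, - y1 - a1 x1 - a3) of the first; when it fails and x1 = x2,
   the two points of the curve coincide and the tangent is used. *)
Definition wadd (F : fieldType) (W : weierstrass F) (P Q : option (F * F)) :
    option (F * F) :=
  match P, Q with
  | None, _ => Q
  | _, None => P
  | Some (x1, y1), Some (x2, y2) =>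
    if (x1 == x2) && (y2 == - y1 - wa1 W * x1 - wa3 W) then None else
    let l :=
      if x1 == x2 then
        (3%:R * x1 ^+ 2 + 2%:R * wa2 W * x1 + wa4 W - wa1 W * y1)
        / (2%:R * y1 + wa1 W * x1 + wa3 W)
      else (y2 - y1) / (x2 - x1) in
    let x3 := l ^+ 2 + wa1 W * l - wa2 W - x1 - x2 in
    Some (x3, - (y1 + l * (x3 - x1)) - wa1 W * x3 - wa3 W)
  end.

Lemma on_curve_wadd (F : fieldType) (W : weierstrass F) P Q :
  on_curve W P -> on_curve W Q -> on_curve W (wadd W P Q).
Proof.
case: P => [[x1 y1]|] //; case: Q => [[x2 y2]|] //= /eqP e1 /eqP e2.
case: ifP => //= nopp; set l := if _ then _ else _.
set x3 := (X in weval _ X _); apply/eqP.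
have -> : weval W x3 (- (y1 + l * (x3 - x1)) - wa1 W * x3 - wa3 W)
        = weval W x3 (y1 + l * (x3 - x1)) by rewrite /weval; ring.
case: (eqVneq x1 x2) nopp @l @x3 => [eqx|nex] nopp l x3.
  subst x2; rewrite /= in nopp.
  have eqy : y2 = y1.
    have /eqP : (y2 - y1) * (y2 - (- y1 - wa1 W * x1 - wa3 W)) = 0.
      transitivity (weval W x1 y2 - weval W x1 y1); last by rewrite e1 e2 subrr.
      by rewrite /weval; ring.
    by rewrite mulf_eq0 !subr_eq0 nopp orbF => /eqP.
  have den : 2%:R * y1 + wa1 W * x1 + wa3 W != 0.
    apply: contraFneq nopp => den0; rewrite eqy -subr_eq0.
    by apply/eqP; rewrite -den0; ring.
  have el : l * (2%:R * y1 + wa1 W * x1 + wa3 W)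
      - (3%:R * x1 ^+ 2 + 2%:R * wa2 W * x1 + wa4 W - wa1 W * y1) = 0.
    by rewrite /l mulfVK ?subrr.
  rewrite (_ : weval _ _ _ = weval W x1 y1 + (x3 - x1) *
    (l * (2%:R * y1 + wa1 W * x1 + wa3 W)
      - (3%:R * x1 ^+ 2 + 2%:R * wa2 W * x1 + wa4 W - wa1 W * y1))).
    by rewrite e1 el mulr0 addr0.
  by rewrite /x3 /weval; move: (l) => m; ring.
have dx : x2 - x1 != 0 by rewrite subr_eq0 eq_sym.
have ey : y2 = y1 + l * (x2 - x1) by rewrite /l mulfVK //; ring.
apply: (mulfI dx); rewrite mulr0.
have -> : (x2 - x1) * weval W x3 (y1 + l * (x3 - x1))
    = (x2 - x3) * weval W x1 y1 + (x3 - x1) * weval W x2 y2.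
  by rewrite ey /x3 /weval; move: (l) => m; ring.
by rewrite e1 e2 !mulr0 addr0.
Qed.

(* E(F) with its group operation *)
Definition point (F : fieldType) (E : elliptic_curve F) : Type :=
  {P : option (F * F) | on_curve E P}.

Definition padd (F : fieldType) (E : elliptic_curve F) (P Q : point E) :
    point E :=
  exist _ (wadd E (val P) (val Q)) (on_curve_wadd (valP P) (valP Q)).

(* A group A is isomorphic to a subgroup of E(F) iff it is the source of
   an injective additive map to E(F). *)
Definition embeds_in_points (A : zmodType) (F : fieldType)
    (E : elliptic_curve F) : Prop :=
  exists f : A -> point E,
    injective f /\ forall u v : A, f (u + v) = padd (f u) (f v).

(* Isomorphisms of Weierstrass curves over a field L are the substitutions
   (x, y) |-> (u^2 x + r, u^3 y + s u^2 x + t) carrying the first equation to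
   u^6 times the second.  L is infinite below, so the equality of the two
   polynomials may be tested on values. *)
Definition weierstrass_iso (L : fieldType) (W W' : weierstrass L) : Prop :=
  exists u r s t : L, u != 0 /\
    forall x y : L,
      weval W (u ^+ 2 * x + r) (u ^+ 3 * y + s * u ^+ 2 * x + t)
      = u ^+ 6 * weval W' x y.

Definition geom_iso (K : fieldType) (Kbar : closedFieldType)
    (iota : {rmorphism K -> Kbar}) (E E' : elliptic_curve K) : Prop :=
  weierstrass_iso (map_weierstrass iota E) (map_weierstrass iota E').

Definition is_algebraic_closure (K : fieldType) (Kbar : closedFieldType)
    (iota : {rmorphism K -> Kbar}) : Prop :=
  forall z : Kbar, algebraicOver iota z.

Local Open Scope classical_set_scope.

(* The Kbar-isomorphism classes (among all elliptic curves over K) that contain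
   a curve E over K with A isomorphic to a subgroup of E(K).  Having such a
   subgroup is not invariant under Kbar-isomorphism, so the class of E also
   contains curves that are not themselves counted. *)
Definition geom_classes (A : zmodType) (K : fieldType) (Kbar : closedFieldType)
    (iota : {rmorphism K -> Kbar}) : set (set (elliptic_curve K)) :=
  [set [set E' | geom_iso iota E E'] | E in [set E | @embeds_in_points A K E]].

(* Main.v *)
Require Import Defs.
From HB Require Import structures.
From mathcomp Require Import all_boot all_order all_algebra all_field.
From mathcomp Require Import finmap ring lra zify.
From mathcomp Require Import boolp classical_sets functions cardinality.

(* An elliptic curve with full 6-torsion over K forces r = sqrt(-3) to be in K
   and yields a K-point (X, Y) of X(6) : Y^2 = X^3 + 1 which is not one of the
   twelve cusps (X = 0, oo, X^3 = -1, X^3 = 8).  Conversely, such a point yields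
   the curve E_t : y^2 + 3t xy + (t^3 - 1) y = x^3, with t = (X^3 + 4)/(3X^2), whose
   6-torsion is rational, and j(E_t) is a non-constant function of X.  So it is
   enough that one noncuspidal point produces infinitely many.

   Duplication X |-> X(X^3 - 8)/(4(X^3 + 1)) does so.  It preserves noncuspidal
   points: otherwise K would be Q(i, sqrt 3) and would contain a square root of
   6 sqrt 3 - 9, which it does not.  Since 2 is inert in Q(r) and [K : Q(r)] = 2,
   a valuation v of K above 2, normalised by v(2) = 2, has integral values; v(X)
   then follows a strictly monotone path under duplication (towards -oo if v(X) < 0,
   towards +oo if v(X) > 2, and one of the two after at most two steps otherwise),
   so that the orbit of X is infinite.  In other words, the additive reduction of X(6)
   at 2 forbids new torsion over K.

   Associativity of the group law is needed only when one of the three points has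
   order 2 or 3: the points T with (T + P) + Q = T + (P + Q) for all P and Q form a
   commutative monoid, and Z/6 x Z/6 is embedded in it. *)

Set Implicit Arguments.
Unset Strict Implicit.
Unset Printing Implicit Defensive.

Import Order.TTheory GRing.Theory Num.Theory.
Local Open Scope ring_scope.

(** * Translation by points of order 2 and 3 *)

Section GroupLaw.
Variables (F : fieldType) (W : weierstrass F).
Implicit Types P Q : option (F * F).

Lemma wadd_opp x y1 y2 : y1 + y2 + wa1 W * x + wa3 W = 0 ->
  wadd W (Some (x, y1)) (Some (x, y2)) = None.
Proof.
move=> e; rewrite /= eqxx /= ifT //.
by apply/eqP/subr0_eq; rewrite -e; ring.
Qed.

Lemma wadd_secant l x1 y1 x2 y2 : x1 != x2 -> l * (x2 - x1) = y2 - y1 ->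
  wadd W (Some (x1, y1)) (Some (x2, y2)) =
  let x3 := l ^+ 2 + wa1 W * l - wa2 W - x1 - x2 in
  Some (x3, - (y1 + l * (x3 - x1)) - wa1 W * x3 - wa3 W).
Proof.
move=> nx el; rewrite /= (negbTE nx) /= -el mulfK // subr_eq0 eq_sym //.
Qed.

Lemma wadd_tangent l x y : 2%:R * y + wa1 W * x + wa3 W != 0 ->
    l * (2%:R * y + wa1 W * x + wa3 W) =
      3%:R * x ^+ 2 + 2%:R * wa2 W * x + wa4 W - wa1 W * y ->
  wadd W (Some (x, y)) (Some (x, y)) =
  let x3 := l ^+ 2 + wa1 W * l - wa2 W - x - x in
  Some (x3, - (y + l * (x3 - x)) - wa1 W * x3 - wa3 W).
Proof.
move=> nM el; rewrite /= eqxx /= ifF; last first.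
  apply: contraNF nM => /eqP e; apply/eqP.
  by transitivity (y - (- y - wa1 W * x - wa3 W)); [ring | rewrite -e subrr].
by rewrite -el mulfK.
Qed.

Lemma on_curve_same_x x y1 y2 :
  on_curve W (Some (x, y1)) -> on_curve W (Some (x, y2)) ->
  y2 = y1 \/ y1 + y2 + wa1 W * x + wa3 W = 0.
Proof.
rewrite /= => /eqP e1 /eqP e2.
have /eqP : (y2 - y1) * (y1 + y2 + wa1 W * x + wa3 W) = 0.
  transitivity (weval W x y2 - weval W x y1); last by rewrite e1 e2 subrr.
  by rewrite /weval; ring.
by rewrite mulf_eq0 subr_eq0 => /orP[] /eqP; [left | right].
Qed.

Lemma waddC P Q : on_curve W P -> on_curve W Q -> wadd W P Q = wadd W Q P.
Proof.
case: P Q => [[x1 y1]|] [[x2 y2]|] // cP cQ.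
have [ex|nx] := eqVneq x1 x2.
  subst x2; case: (on_curve_same_x cP cQ) => [-> //|e].
  by rewrite !wadd_opp // -e; ring.
have d0 : x2 - x1 != 0 by rewrite subr_eq0 eq_sym.
rewrite (@wadd_secant ((y2 - y1) / (x2 - x1))) ?divfK //.
rewrite (@wadd_secant ((y2 - y1) / (x2 - x1)) x2) 1?eq_sym //; last first.
  by field; rewrite d0.
cbv zeta; congr (Some (_, _)); [ring | field; rewrite d0 //].
Qed.

Lemma wadd0P P : wadd W None P = P. Proof. by []. Qed.
Lemma waddP0 P : wadd W P None = P. Proof. by case: P => [[]|]. Qed.

Definition wassoc (T : option (F * F)) := forall P Q,
  on_curve W P -> on_curve W Q ->
  wadd W (wadd W T P) Q = wadd W T (wadd W P Q).

End GroupLaw.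

Arguments wadd : simpl never.
Arguments on_curve : simpl never.

(** * Translation by the origin on [y^2 = x (x^2 + a x + b)] *)

Section TwoTorsion.
Variables (F : fieldType) (a b : F).
Hypotheses (n2 : 2%:R != 0 :> F) (nb : b != 0) (nd : a ^+ 2 - 4%:R * b != 0).
Let W := Weierstrass 0 a 0 b 0.
Let T := Some (0 : F, 0 : F).

Let onW x y : on_curve W (Some (x, y)) = (y ^+ 2 == x * (x ^+ 2 + a * x + b)).
Proof.
by rewrite -[RHS]subr_eq0 /on_curve /weval /=; congr (_ == _); ring.
Qed.

Let addT x y : on_curve W (Some (x, y)) -> x != 0 ->
  wadd W T (Some (x, y)) = Some (b / x, - b * y / x ^+ 2).
Proof.
rewrite onW => /eqP e nx.
rewrite (@wadd_secant _ _ (y / x)) ?subr0 ?divfK 1?eq_sym //=.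
have y2 : (y / x) ^+ 2 = (x ^+ 2 + a * x + b) / x.
  by rewrite expr_div_n e; field.
  by rewrite y2; congr (Some (_, _)); field.
by rewrite eq_sym.
Qed.

Let onT : on_curve W T. Proof. by rewrite onW; apply/eqP; ring. Qed.

Let on0 y : on_curve W (Some (0, y)) -> y = 0.
Proof. by rewrite onW mul0r sqrf_eq0 => /eqP. Qed.

Let addTT : wadd W T T = None.
Proof. by rewrite /T wadd_opp //=; ring. Qed.

Let addTTP P : on_curve W P -> wadd W T (wadd W T P) = P.
Proof.
case: P => [[x y]|] cP; last by rewrite waddP0 addTT.
have [x0|nx] := eqVneq x 0.
  by subst x; rewrite (on0 cP) -/T addTT.
have c' := on_curve_wadd onT cP.
rewrite addT // in c' *; rewrite addT ?mulf_neq0 ?invr_eq0 //.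
by congr (Some (_, _)); field; rewrite nx nb.
Qed.

(** Off [T] and infinity, translation by [T] is [(x, y) |-> (b / x, - b y / x^2)]. In each relative
    position of [P], [Q] and [T], the curve equations eliminate the coefficients [a], [b], and both
    sides become the same rational function. *)
Lemma wassoc_2torsion : wassoc W T.
Proof.
case=> [[x1 y1]|] [[x2 y2]|] cP cQ; rewrite ?(wadd0P, waddP0) //.
have [x0|nx1] := eqVneq x1 0.
  by subst x1; rewrite (on0 cP) -/T addTT addTTP.
have [x0|nx2] := eqVneq x2 0.
  subst x2; rewrite (on0 cQ) -/T.
  by rewrite (waddC (on_curve_wadd onT cP) onT) (waddC cP onT).
have cPT := on_curve_wadd onT cP.
have cPQ := on_curve_wadd cP cQ.
rewrite (addT cP) // in cPT *.
move: (cP) (cQ); rewrite !onW => /eqP e1 /eqP e2.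
have [ex|nx] := eqVneq x1 x2.
  subst x2; case: (on_curve_same_x cP cQ) => [ey|e].
    subst y2.
    have [y0|ny] := eqVneq y1 0.
      subst y1; rewrite wadd_opp; last by rewrite /=; ring.
      have [bx|nbx] := eqVneq (b / x1) x1.
        have eb : b = x1 ^+ 2 by rewrite -(divfK nx1 b) bx.
        (* Here [x1] would be a double root of [x^2 + a x + b]. *)
        case/eqP: nd.
        move/esym/eqP: e1; rewrite expr0n mulf_eq0 (negbTE nx1) /= => /eqP e1.
        have -> : a = - 2%:R * x1.
          apply: (mulIf nx1); apply/subr0_eq; rewrite -e1 eb; ring.
        by rewrite eb; ring.
      rewrite (@wadd_secant _ _ 0) //=; last by ring.
      move/esym/eqP: e1; rewrite expr0n mulf_eq0 (negbTE nx1) /= => /eqP e1.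
      congr (Some (_, _)); last by ring.
      transitivity (- (x1 ^+ 2 + a * x1 + b) / x1); first by field.
      by rewrite e1; ring.
    have nM : 2%:R * y1 + wa1 W * x1 + wa3 W != 0.
      by rewrite /= mul0r !addr0 mulf_neq0.
    set l := (3%:R * x1 ^+ 2 + 2%:R * a * x1 + b) / (2%:R * y1).
    have el : l * (2%:R * y1 + wa1 W * x1 + wa3 W) =
      3%:R * x1 ^+ 2 + 2%:R * wa2 W * x1 + wa4 W - wa1 W * y1.
      by rewrite /= /l; field; rewrite n2 ny.
    have ea : a = y1 ^+ 2 / x1 ^+ 2 - x1 - b / x1.
      by rewrite e1; field.
    (* The abscissa of [2P] is a square, which vanishes exactly when [b = x1^2], i.e. when [T + P]
       has the abscissa of [P]. In that case [T + P = - P] and [2P = T]. *)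
    have ex3 : l ^+ 2 - a - x1 - x1 = (b - x1 ^+ 2) ^+ 2 / (2%:R * y1) ^+ 2.
      rewrite /l ea; field; rewrite ?n2 ?ny ?nx1 //.
    have [bx|nbx] := eqVneq (b / x1) x1.
      have eb : b = x1 ^+ 2 by rewrite -(divfK nx1 b) bx.
      rewrite (wadd_tangent nM el) /= mul0r addr0 ex3 bx eb subrr.
      rewrite expr0n mul0r !mul0r !subr0 sub0r -/W.
      rewrite [LHS]wadd_opp; last first.
        by rewrite /=; field.
      have -> : - (y1 + l * - x1) = 0.
        by rewrite /l ea eb; field; rewrite ny n2 nx1.
      by rewrite -/T addTT.
    have nx3 : l ^+ 2 - a - x1 - x1 != 0.
      rewrite ex3 mulf_neq0 ?invr_eq0 ?sqrf_eq0 ?mulf_neq0 //.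
      by apply: contraNneq nbx => /subr0_eq ->; rewrite expr2 mulfK.
    move: (cPQ); rewrite (wadd_tangent nM el) /= mul0r addr0 -/W => cR.
    rewrite addT //.
    have nd1 : x1 - b / x1 != 0 by rewrite subr_eq0 eq_sym.
    have nd2 : x1 ^+ 2 - b != 0.
      by apply: contraNneq nbx => /subr0_eq <-; rewrite expr2 mulfK.
    have nd3 : b - x1 ^+ 2 != 0 by rewrite -opprB oppr_eq0.
    rewrite (@wadd_secant _ _ ((y1 + b * y1 / x1 ^+ 2) / (x1 - b / x1))) //; last first.
      by rewrite divfK //; field.
    cbv zeta; rewrite [wa1 _]/= [wa2 _]/= [wa3 _]/= ex3 /l ea.
    congr (Some (_, _)); field; rewrite ?nd2 ?nd3 ?ny ?n2 ?nx1 //.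
  have ey : y2 = - y1 by apply/subr0_eq; rewrite -e /=; ring.
  subst y2; rewrite [wadd W (Some (x1, y1)) _]wadd_opp /=; last by ring.
  rewrite -/W -/T.
  have [bx|nbx] := eqVneq (b / x1) x1.
    have eb : b = x1 ^+ 2 by rewrite -(divfK nx1 b) bx.
    rewrite bx eb.
    have ny : y1 != 0.
      apply: contraNneq nd => y0; move/esym/eqP: e1.
      rewrite y0 expr0n mulf_eq0 (negbTE nx1) /= => /eqP e1.
      have -> : a = - 2%:R * x1.
        apply: (mulIf nx1); apply/subr0_eq; rewrite -e1 eb; ring.
      by rewrite eb; apply/eqP; ring.
    have -> : - x1 ^+ 2 * y1 / x1 ^+ 2 = - y1 by field.
    have ea : a = y1 ^+ 2 / x1 ^+ 2 - x1 - b / x1 by rewrite e1; field.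
    have nM : 2%:R * - y1 + wa1 W * x1 + wa3 W != 0.
      by rewrite /= mul0r !addr0 mulf_neq0 // oppr_eq0.
    rewrite (@wadd_tangent _ _ (- y1 / x1)) //=.
      by congr (Some (_, _)); rewrite ea eb; field.
    by rewrite ea eb; field.
  rewrite (@wadd_secant _ _ (- y1 / x1)) //.
    have ea : a = y1 ^+ 2 / x1 ^+ 2 - x1 - b / x1 by rewrite e1; field.
    by cbv zeta; congr (Some (_, _)); rewrite /= ea; field.
  by field.
have nd1 : x2 - x1 != 0 by rewrite subr_eq0 eq_sym.
pose l := (y2 - y1) / (x2 - x1); pose m := y1 - l * x1.
have el : l * (x2 - x1) = y2 - y1 by rewrite divfK.
have ey1 : y1 = l * x1 + m by rewrite /m; ring.
have ey2 : y2 = l * x2 + m by rewrite -(subrK y1 y2) -el /m; ring.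
(* Vieta for [x (x^2 + a x + b) = (l x + m)^2]: the product of the roots is [m^2], which gives the
   third abscissa; the other two symmetric functions give [b] and [a]. *)
pose x3 := m ^+ 2 / (x1 * x2).
have eb : b = x1 * x2 + m ^+ 2 / x1 + m ^+ 2 / x2 + 2%:R * l * m.
  apply: (mulfI nd1); apply: (mulfI nx1); apply: (mulfI nx2).
  have -> : x2 * (x1 * ((x2 - x1) * b)) = x2 ^+ 2 * (y1 ^+ 2 - x1 ^+ 3)
     - x1 ^+ 2 * (y2 ^+ 2 - x2 ^+ 3) by rewrite e1 e2; ring.
  by rewrite ey1 ey2; field; rewrite nx1 nx2.
have ea : a = l ^+ 2 - x1 - x2 - x3.
  apply: (mulfI nx1); apply: (mulfI nx1).
  have -> : x1 * (x1 * a) = y1 ^+ 2 - x1 ^+ 3 - b * x1 by rewrite e1; ring.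
  by rewrite ey1 eb /x3; field; rewrite nx1 nx2.
have ePQ : wadd W (Some (x1, y1)) (Some (x2, y2)) =
    Some (x3, - (l * x3 + m)).
  rewrite (wadd_secant W nx el) /=; have -> : l ^+ 2 + 0 * l - a - x1 - x2 = x3.
    by rewrite ea; ring.
  by congr (Some (_, _)); rewrite ey1; ring.
rewrite ePQ; rewrite ePQ in cPQ.
have n4 : 4%:R != 0 :> F by rewrite (natrM _ 2 2) mulf_neq0.
(* For [m = 0] the chord passes through [T], so that [P + Q = T]. *)
have [m0|nm] := eqVneq m 0.
  have x30 : x3 = 0 by rewrite /x3 m0; ring.
  have ebx : b = x1 * x2 by rewrite eb m0; ring.
  rewrite x30 m0 mulr0 add0r oppr0 -/T addTT.
  have -> : b / x1 = x2 by rewrite ebx; field.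
  by rewrite wadd_opp //= ey1 ey2 m0 ebx; field.
have nx3 : x3 != 0 by rewrite mulf_neq0 ?invr_eq0 ?mulf_neq0 ?sqrf_eq0.
rewrite (addT cPQ nx3).
have [bx|nbx] := eqVneq (b / x1) x2.
  have ebx : b = x1 * x2 by rewrite -bx; field.
  rewrite bx in cPT *.
  (* [Q] is [T + P] or its opposite; the opposite is collinear with [P] and [T], against [nm]. So
     the sum on the left is a doubling of [Q]. *)
  have {ey2 e2 el} ey2' : y2 = - b * y1 / x1 ^+ 2.
    case: (on_curve_same_x cPT cQ) => // e.
    case/eqP: nm; rewrite /m /l.
    have -> : y2 = b * y1 / x1 ^+ 2.
      by apply/subr0_eq; rewrite -e /=; ring.
    by rewrite ebx; field; rewrite nd1 nx1.
  have ny1 : y1 != 0.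
    apply: contraNneq nm => y0; rewrite /m /l ey2' y0; apply/eqP; ring.
  have em : m = 2%:R * x2 * y1 / (x2 - x1).
    by rewrite /m /l ey2' ebx; field; rewrite nx1 nd1.
  have ny2 : y2 != 0.
    by rewrite ey2' !mulf_neq0 ?oppr_eq0 // invr_eq0 sqrf_eq0.
  rewrite -ey2'.
  rewrite (@wadd_tangent _ _ ((3%:R * x2 ^+ 2 + 2%:R * a * x2 + b) / (2%:R * y2))).
  - congr (Some (_, _)); rewrite ?[wa1 _]/= ?[wa2 _]/= ?[wa3 _]/= ea /x3 em /l ey2' ebx; field;
      by rewrite nx1 nx2 nd1 ny1 n2 n4 oppr_eq0 mulf_neq0.
  - by rewrite /= mul0r !addr0 mulf_neq0.
  - by rewrite /=; field; rewrite n2 ny2.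
have nd2 : x2 - b / x1 != 0 by rewrite subr_eq0 eq_sym.
rewrite (@wadd_secant _ _ ((y2 + b * y1 / x1 ^+ 2) / (x2 - b / x1))) //; last first.
  by rewrite divfK //; field.
clearbody m l.
(* This is the denominator left once [b] is eliminated; [x2 - b / x1] is a multiple of it. *)
have nd3 : m * (x1 + x2) + 2%:R * l * x1 * x2 != 0.
  apply: contraNneq nd2 => e; apply/eqP.
  transitivity (- (m / (x1 ^+ 2 * x2)) * (m * (x1 + x2) + 2%:R * l * x1 * x2)).
    by rewrite eb; field; rewrite nx1 nx2.
  by rewrite e mulr0.
move: nd2; rewrite [wa1 _]/= [wa2 _]/= [wa3 _]/= ea /x3 eb ey1 ey2 => nd2.
congr (Some (_, _)); field; rewrite nx1 nx2 nm /=;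
  set d := (X in X != 0);
  (have -> : d = - (m * (m * (x1 + x2) + 2%:R * l * x1 * x2)) by rewrite /d; ring);
  by rewrite oppr_eq0 mulf_neq0.
Qed.
End TwoTorsion.

Ltac nonzero :=
  rewrite /= ?(mulf_eq0, expf_eq0, oppr_eq0, invr_eq0) ?negb_or /=;
  repeat (apply/andP; split); try done; try assumption.

(** * Translation by the flex at the origin on [y^2 + a x y + b y = x^3] *)

Section ThreeTorsion.
Variables (F : fieldType) (a b : F).
Hypotheses (nb : b != 0) (nd : a ^+ 3 - 27%:R * b != 0).
Let W := Weierstrass a 0 b 0 0.
Let T := Some (0 : F, 0 : F).
Let T' := Some (0 : F, - b).

Let onW x y : on_curve W (Some (x, y)) = (y * (y + a * x + b) == x ^+ 3).
Proof.
by rewrite -[RHS]subr_eq0 /on_curve /weval /=; congr (_ == _); ring.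
Qed.

Let y_neq0 x y : on_curve W (Some (x, y)) -> x != 0 -> y != 0.
Proof.
rewrite onW => e nx; apply: contraNneq nx => y0.
by move: e; rewrite y0 mul0r eq_sym expf_eq0.
Qed.

Let addT x y : on_curve W (Some (x, y)) -> x != 0 ->
  wadd W T (Some (x, y)) = Some (- b * y / x ^+ 2, - b ^+ 2 * y / x ^+ 3).
Proof.
move=> c nx; have ny := y_neq0 c nx; move: c; rewrite onW => /eqP e.
have eb : b = x ^+ 3 / y - y - a * x by rewrite -e; field.
rewrite (@wadd_secant _ _ (y / x)) ?subr0 ?divfK //=; last by rewrite eq_sym.
by rewrite eb; congr (Some (_, _)); field; nonzero.
Qed.

Let addT' x y : on_curve W (Some (x, y)) -> x != 0 ->
  wadd W T' (Some (x, y)) = Some (b * x / y, - b * x ^+ 3 / y ^+ 2).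
Proof.
move=> c nx; have ny := y_neq0 c nx; move: c; rewrite onW => /eqP e.
have eb : b = x ^+ 3 / y - y - a * x by rewrite -e; field.
rewrite (@wadd_secant _ _ ((y + b) / x)) ?subr0 ?opprK ?divfK //=; last by rewrite eq_sym.
by rewrite eb; congr (Some (_, _)); field; nonzero.
Qed.

Let onT : on_curve W T. Proof. by rewrite onW; apply/eqP; ring. Qed.
Let onT' : on_curve W T'. Proof. by rewrite onW; apply/eqP; ring. Qed.

Let on0 y : on_curve W (Some (0, y)) -> y = 0 \/ y = - b.
Proof.
rewrite onW mulr0 addr0 expr0n mulf_eq0 => /orP[/eqP|]; first by left.
by rewrite addr_eq0 => /eqP; right.
Qed.

Let addTT : wadd W T T = T'.
Proof.
rewrite /T (@wadd_tangent _ _ 0) /=; last by ring.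
  by congr (Some (_, _)); ring.
by rewrite !mulr0 !add0r.
Qed.

Let addTT' : wadd W T T' = None.
Proof. by rewrite /T /T' wadd_opp //=; ring. Qed.

Let addT'T : wadd W T' T = None.
Proof. by rewrite (waddC onT' onT) addTT'. Qed.

Let addT'T' : wadd W T' T' = T.
Proof.
rewrite /T' (@wadd_tangent _ _ (- a)) /=; last by ring.
  by congr (Some (_, _)); ring.
by rewrite mulr0 addr0 (_ : _ + b = - b) ?oppr_eq0 //; ring.
Qed.

Let addTT'P P : on_curve W P -> wadd W T (wadd W T' P) = P.
Proof.
case: P => [[x y]|] cP; last by rewrite waddP0 addTT'.
have [x0|nx] := eqVneq x 0.
  by subst x; case: (on0 cP) => ->;
    rewrite -/T -/T' ?(addTT, addTT', addT'T, addT'T', waddP0).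
have c' := on_curve_wadd onT' cP; have ny := y_neq0 cP nx.
rewrite addT' // in c' *; rewrite addT ?mulf_neq0 ?invr_eq0 //.
by congr (Some (_, _)); field; nonzero.
Qed.

Let addT'TP P : on_curve W P -> wadd W T' (wadd W T P) = P.
Proof.
case: P => [[x y]|] cP; last by rewrite waddP0 addT'T.
have [x0|nx] := eqVneq x 0.
  by subst x; case: (on0 cP) => ->;
    rewrite -/T -/T' ?(addTT, addTT', addT'T, addT'T', waddP0).
have c' := on_curve_wadd onT cP; have ny := y_neq0 cP nx.
have nx' : - b * y / x ^+ 2 != 0.
  by rewrite !mulf_neq0 ?oppr_eq0 ?invr_eq0 ?sqrf_eq0.
rewrite addT // in c' *; rewrite addT' //.
by congr (Some (_, _)); field; nonzero.
Qed.

Let addTTP P : on_curve W P -> wadd W T (wadd W T P) = wadd W T' P.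
Proof.
case: P => [[x y]|] cP; last by rewrite !waddP0 addTT.
have [x0|nx] := eqVneq x 0.
  by subst x; case: (on0 cP) => ->;
    rewrite -/T -/T' ?(addTT, addTT', addT'T, addT'T', waddP0).
have c' := on_curve_wadd onT cP; have ny := y_neq0 cP nx.
have nx' : - b * y / x ^+ 2 != 0.
  by rewrite !mulf_neq0 ?oppr_eq0 ?invr_eq0 ?sqrf_eq0.
rewrite addT' //.
rewrite addT // in c' *; rewrite addT //.
by congr (Some (_, _)); field; nonzero.
Qed.

Let addTN x y : on_curve W (Some (x, y)) -> y != 0 ->
  wadd W T (Some (x, - y - a * x - b)) = Some (b * x / y, b ^+ 2 / y).
Proof.
move=> c ny; have [x0|nx] := eqVneq x 0.
  subst x; case: (on0 c) => ey; first by rewrite ey eqxx in ny.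
  rewrite ey (_ : _ - b = 0) -/T; last by ring.
  by rewrite addTT; congr (Some (_, _)); field; nonzero.
have c' : on_curve W (Some (x, - y - a * x - b)).
  by move: c; rewrite !onW => /eqP <-; apply/eqP; ring.
rewrite addT //; move: c; rewrite !onW => /eqP e.
have -> : - y - a * x - b = - x ^+ 3 / y by rewrite -e; field.
by congr (Some (_, _)); field; nonzero.
Qed.

(* The formula for [a] holds when the line [y = l x + m] is the chord through the two
   points and also, with [x1 = x2], when it is a tangent, so that both cases are
   handled at once. *)
Let wassoc_line x1 y1 x2 y2 l m :
    on_curve W (Some (x1, y1)) -> on_curve W (Some (x2, y2)) ->
    x1 != 0 -> x2 != 0 -> y1 = l * x1 + m -> y2 = l * x2 + m ->
    a = - l + (l * x1 * x2 * (x1 + x2) + m * (x1 ^+ 2 + x1 * x2 + x2 ^+ 2))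
          / (y1 * y2) ->
    (let x3 := l ^+ 2 + a * l - x1 - x2 in
    wadd W (Some (x1, y1)) (Some (x2, y2))
      = Some (x3, - (l * x3 + m) - a * x3 - b)) ->
  wadd W (wadd W T (Some (x1, y1))) (Some (x2, y2))
  = wadd W T (wadd W (Some (x1, y1)) (Some (x2, y2))).
Proof.
move=> cP cQ nx1 nx2 ey1 ey2 ea; set x3 := l ^+ 2 + _ - _ - _ => /= ePQ.
have ny1 := y_neq0 cP nx1; have ny2 := y_neq0 cQ nx2.
have eb0 : b = x1 ^+ 3 / y1 - y1 - a * x1.
  by move: cP; rewrite onW => /eqP <-; field.
subst y1 y2; set y1 := l * x1 + m in ny1 *; set y2 := l * x2 + m in ny2 *.
pose D := l * x1 * x2 + m * (x1 + x2).
have eb : b = - m - x1 * x2 * D / (y1 * y2).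
  by rewrite eb0 ea /D /y1 /y2; field; nonzero.
have ex3 : x3 = - m * D / (y1 * y2).
  by rewrite /x3 ea /D /y1 /y2; field; nonzero.
(* The ordinates of the three points on the line have product [m^3]: this is the norm of [l x + m]
   modulo the cubic whose roots are the three abscissas. *)
have ey3 : l * x3 + m = m ^+ 3 / (y1 * y2).
  by rewrite ex3 /D /y1 /y2; field; nonzero.
have cPQ := on_curve_wadd cP cQ; have cPT := on_curve_wadd onT cP.
rewrite ePQ in cPQ *; rewrite addT // in cPT *.
have cR : on_curve W (Some (x3, l * x3 + m)).
  by move: cPQ; rewrite !onW => /eqP <-; apply/eqP; ring.
(* For [m = 0] the line passes through [T], so that [P + Q = - T] and [Q = - (T + P)]. *)
have [m0|nm] := eqVneq m 0.
  have x30 : x3 = 0 by rewrite ex3 m0; ring.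
  have y30 : l * x3 + m = 0 by rewrite ey3 m0; ring.
  rewrite y30 x30 oppr0 mulr0 subr0 sub0r -/T' addTT'.
  have nl : l != 0 by apply: contraNneq ny1 => l0; rewrite /y1 l0 m0; apply/eqP; ring.
  rewrite (_ : - b * y1 / x1 ^+ 2 = x2) ?wadd_opp //=;
    rewrite ?ea eb /D /y1 /y2 m0; field;
    move: ny1 ny2; rewrite /y1 /y2 m0 !addr0 => ny1 ny2; nonzero.
rewrite addTN //; last by rewrite ey3; nonzero.
have [bx|nbx] := eqVneq (- b * y1 / x1 ^+ 2) x2.
  have bxy : b * y1 = - x2 * x1 ^+ 2 by rewrite -bx; field; nonzero.
  have h1 : m * (x1 * x2 ^+ 2 + y1 * y2) = 0.
    transitivity (m * x1 * x2 ^+ 2 + m * (y1 * y2) + b * y1 * y2 + x2 * x1 ^+ 2 * y2).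
      by rewrite bxy; ring.
    by rewrite eb /D /y1 /y2; field; nonzero.
  move/eqP: h1; rewrite mulf_eq0 (negbTE nm) /= addr_eq0 => /eqP h1.
  have bxy2 : y2 * x1 = b * x2.
    apply: (mulfI ny1); transitivity (- x1 * - (y1 * y2)); first by ring.
    by rewrite -h1 [RHS]mulrCA mulrA bxy; ring.
  have ey : y2 = - b ^+ 2 * y1 / x1 ^+ 3.
    apply: (mulIf nx1); rewrite bxy2 -bx; field; nonzero.
  (* Here [Q = T + P], and this quantity is [y2 (2 y2 + a x2 + b)]: the tangent at [Q] is not
     vertical. Otherwise [x1 = x2], then [y2 = b], [a x2 = - 3 b], [x2^3 = - b^2], and
     [a^3 = 27 b]. *)
  have nM : x2 ^+ 3 + y2 ^+ 2 != 0.
    apply/negP => /eqP e.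
    have : y2 * m * (x2 - x1) = 0.
      transitivity (- x1 * y2 ^+ 2 + x2 * (y1 * y2)); first by rewrite /y1 /y2; ring.
      transitivity (- x1 * (x2 ^+ 3 + y2 ^+ 2)); last by rewrite e mulr0.
      by rewrite -[y1 * y2]opprK -h1; ring.
    move/eqP; rewrite !mulf_eq0 (negbTE nm) (negbTE ny2) /= subr_eq0 => /eqP ex.
    have eyb : y2 = b by apply: (mulIf nx1); rewrite bxy2 ex.
    have eM : a * x2 = - 3%:R * b.
      apply: (mulfI ny2); move: cQ; rewrite onW -/y2 => /eqP cQ'.
      transitivity (y2 * (y2 + a * x2 + b) - y2 * (y2 + b)); first by ring.
      have -> : y2 * (y2 + a * x2 + b) = - y2 ^+ 2.
        by rewrite cQ'; apply/eqP; rewrite -addr_eq0 e.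
      by rewrite eyb; ring.
    case/eqP: nd; apply: (mulIf (expf_neq0 3 nx2)).
    have -> : (a ^+ 3 - 27%:R * b) * x2 ^+ 3 = (a * x2) ^+ 3 - 27%:R * b * x2 ^+ 3 by ring.
    have -> : x2 ^+ 3 = - b ^+ 2 by rewrite -eyb; apply/eqP; rewrite -addr_eq0 e.
    by rewrite eM; ring.
  have nx : x2 - x1 != 0.
    apply: contraNneq nM => /subr0_eq ex.
    have : x1 * (x2 ^+ 3 + y2 ^+ 2) == 0.
      apply/eqP; transitivity (x2 * (x1 * x2 ^+ 2) + y2 * (y2 * x1)); first by ring.
      by rewrite h1 /y1 /y2 ex; ring.
    by rewrite mulf_eq0 (negbTE nx1).
  have emm : m = (y1 * x2 - y2 * x1) / (x2 - x1) by rewrite /y1 /y2; field.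
  have el : l = (y2 - y1) / (x2 - x1) by rewrite /y1 /y2; field.
  rewrite -ey bx ey3 ex3 /D.
  have ey1 : y1 = - x1 * x2 ^+ 2 / y2 by rewrite mulNr h1; field; nonzero.
  have eb1 : b = y2 * x1 / x2 by rewrite bxy2; field.
  have ea1 : a = (x2 ^+ 3 / y2 - y2 - b) / x2.
    by move: cQ; rewrite onW -/y2 => /eqP <-; field; nonzero.
  have eM : 2%:R * y2 + a * x2 + b = (x2 ^+ 3 + y2 ^+ 2) / y2.
    by rewrite ea1; field; nonzero.
  rewrite (@wadd_tangent _ _ ((3%:R * x2 ^+ 2 - a * y2) * y2 / (x2 ^+ 3 + y2 ^+ 2))).
  - move: nm; rewrite [wa1 _]/= [wa2 _]/= [wa3 _]/= emm el; clearbody y1 y2.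
    rewrite ea1 eb1 ey1 => nm.
    have nM' : - x1 * x2 ^+ 2 * x2 + - (y2 * x1) * y2 != 0.
      rewrite (_ : _ + _ = - x1 * (x2 ^+ 3 + y2 ^+ 2)); last by ring.
      by nonzero.
    by congr (Some (_, _)); field; nonzero.
  - by rewrite [wa1 _]/= [wa3 _]/= eM; nonzero.
  - by rewrite [wa1 _]/= [wa2 _]/= [wa3 _]/= eM [wa4 _]/=; field; nonzero.
have nd2 : x2 + b * y1 / x1 ^+ 2 != 0.
  apply: contraNneq nbx => e; apply/eqP/esym/subr0_eq; rewrite -e; ring.
rewrite (@wadd_secant _ _ ((y2 + b ^+ 2 * y1 / x1 ^+ 3) / (x2 + b * y1 / x1 ^+ 2))) //; last first.
  by rewrite -/y1 mulNr mulNr opprK divfK // !mulNr opprK.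
rewrite [wa1 _]/= [wa2 _]/= [wa3 _]/= ey3 ex3 ea; rewrite eb in nd2 *.
have nd3 : x2 * ((l * x2 + m) * x1 ^+ 2) +
    (- m * ((l * x1 + m) * (l * x2 + m)) -
      x1 * x2 * (l * x1 * x2 + m * (x1 + x2))) != 0.
  have := mulf_neq0 nd2 (mulf_neq0 ny2 (expf_neq0 2 nx1)).
  set u := (X in X != 0); set v := (X in _ -> X != 0); suff -> : u = v by [].
  by rewrite /u /v /D /y1 /y2; field; nonzero.
by congr (Some (_, _)); rewrite /D /y1 /y2; field; nonzero.
Qed.

(** The positions where [P] or [Q] is [T] or [- T], and the one where [Q = - P], are treated by
    hand; chords and tangents both go through [wassoc_line]. *)
Lemma wassoc_3torsion : wassoc W T.
Proof.
case=> [[x1 y1]|] [[x2 y2]|] cP cQ; rewrite ?(wadd0P, waddP0) //.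
have [x0|nx1] := eqVneq x1 0.
  subst x1; case: (on0 cP) => ->; rewrite -/T -/T'.
    by rewrite addTT addTTP.
  by rewrite addTT' addTT'P.
have cPT := on_curve_wadd onT cP.
have [x0|nx2] := eqVneq x2 0.
  subst x2; case: (on0 cQ) => ->; rewrite -/T -/T'.
    by rewrite (waddC cPT onT) (waddC cP onT).
  by rewrite (waddC cPT onT') (waddC cP onT') addTT'P // addT'TP.
have ny1 := y_neq0 cP nx1; have ny2 := y_neq0 cQ nx2.
move: (cP) (cQ); rewrite !onW => /eqP e1 /eqP e2.
have ea x y : y != 0 -> y * (y + a * x + b) = x ^+ 3 -> b = x ^+ 3 / y - y - a * x.
  by move=> ny <-; field.
have eb1 := ea _ _ ny1 e1.
have [ex|nx] := eqVneq x1 x2; last first.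
  have nx' : x2 - x1 != 0 by rewrite subr_eq0 eq_sym.
  have eb2 := ea _ _ ny2 e2.
  pose l := (y2 - y1) / (x2 - x1); pose m := y1 - l * x1.
  have ey1 : y1 = l * x1 + m by rewrite /m; ring.
  have ey2 : y2 = l * x2 + m by rewrite /m /l; field.
  apply: (wassoc_line (l := l) (m := m)) => //.
    apply: (mulfI nx').
    have -> : (x2 - x1) * a = (x2 ^+ 3 / y2 - y2) - (x1 ^+ 3 / y1 - y1).
      transitivity (b + a * x2 - (b + a * x1)); first by ring.
      by rewrite {1}eb2 eb1; ring.
    by clearbody m l; subst y1 y2; field; nonzero.
  rewrite (wadd_secant W nx (l := l)); last by rewrite divfK.
  by rewrite /= subr0 ey1; congr (Some (_, _)); ring.
subst x2; have [e|ne] := eqVneq (y1 + y2 + a * x1 + b) 0.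
  have ey2 : y2 = - x1 ^+ 3 / y1.
    have -> : y2 = - (y1 + a * x1 + b) by apply/subr0_eq; rewrite -e; ring.
    by rewrite -e1; field.
  rewrite [wadd W (Some (x1, y1)) _]wadd_opp // waddP0 addT // in cPT *.
  have ea1 : a = (x1 ^+ 3 / y1 - y1 - b) / x1 by rewrite eb1; field; nonzero.
  have [bx|nbx] := eqVneq (- b * y1 / x1 ^+ 2) x1.
    have ebx : b = y2.
      apply: (mulIf ny1); rewrite ey2 divfK //.
      transitivity (- (- b * y1 / x1 ^+ 2) * x1 ^+ 2); first by field.
      by rewrite bx; ring.
    have ey : - b ^+ 2 * y1 / x1 ^+ 3 = y2.
      by rewrite ebx ey2; field; nonzero.
    have ey1 : y1 = - x1 ^+ 3 / b by rewrite ebx ey2; field; nonzero.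
    (* A vertical tangent would give [a x1 = - 3 b] and [x1^3 = - b^2], hence [a^3 = 27 b]. *)
    have nM : 3%:R * b + a * x1 != 0.
      apply: contraNneq nd => eM; apply/eqP; apply: (mulIf (expf_neq0 3 nx1)).
      have eax : a * x1 = - 3%:R * b by apply/subr0_eq; rewrite -eM; ring.
      have ex3 : x1 ^+ 3 = - b ^+ 2.
        apply/subr0_eq; transitivity (- b * (y1 - b)); first by rewrite ey1; field.
        have -> : y1 = - (3%:R * b + a * x1) + b + (y1 + y2 + a * x1 + b).
          by rewrite -ebx; ring.
        by rewrite e eM; ring.
      have -> : (a ^+ 3 - 27%:R * b) * x1 ^+ 3 = (a * x1) ^+ 3 - 27%:R * b * x1 ^+ 3 by ring.
      by rewrite eax ex3; ring.
    rewrite bx ey -ebx.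
    rewrite (@wadd_tangent _ _ (2%:R * b / x1)) /=.
    - by congr (Some (_, _)); rewrite ea1 ey1; field; nonzero.
    - by rewrite (_ : _ + b = 3%:R * b + a * x1) //; ring.
    - by rewrite ea1 ey1; field; nonzero.
  rewrite (@wadd_secant _ _ ((y2 + b) / x1)) //=.
    by congr (Some (_, _)); rewrite ea1 ey2; field; nonzero.
  by rewrite ey2; field; nonzero.
have ey : y2 = y1.
  by case: (on_curve_same_x cP cQ) => //= /eqP; rewrite (negbTE ne).
subst y2.
have eM : 2%:R * y1 + wa1 W * x1 + wa3 W = y1 + x1 ^+ 3 / y1.
  by rewrite /= {1}eb1; ring.
have nM : 2%:R * y1 + wa1 W * x1 + wa3 W != 0.
  by move: ne; congr (_ != 0); rewrite /=; ring.
pose l := (3%:R * x1 ^+ 2 - a * y1) / (2%:R * y1 + wa1 W * x1 + wa3 W).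
pose m := y1 - l * x1.
have ey1 : y1 = l * x1 + m by rewrite /m; ring.
have el : l * (y1 + x1 ^+ 3 / y1) = 3%:R * x1 ^+ 2 - a * y1.
  by rewrite -eM /l divfK.
apply: (wassoc_line (l := l) (m := m)) => //.
  have -> : a = (3%:R * x1 ^+ 2 - l * (y1 + x1 ^+ 3 / y1)) / y1.
    by rewrite el; field.
  by clearbody m l; subst y1; field.
rewrite (wadd_tangent nM (l := l)); last by rewrite eM el /=; ring.
by rewrite /= subr0 ey1; congr (Some (_, _)); ring.
Qed.
End ThreeTorsion.

(** * Invariance of the addition law under substitutions with [u = 1] *)

Section Shift.
Variables (F : fieldType) (r s t : F).
Implicit Type W : weierstrass F.

(** These are the standard coefficient formulas for the substitution
    [(x, y) |-> (x + r, y + s x + t)], under which [pshift] carries points of the new curve to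
    points of [W]. *)
Definition wshift W : weierstrass F :=
  let: Weierstrass a1 a2 a3 a4 a6 := W in
  Weierstrass (a1 + 2%:R * s) (a2 - s * a1 + 3%:R * r - s ^+ 2)
    (a3 + r * a1 + 2%:R * t)
    (a4 - s * a3 + 2%:R * r * a2 - (t + r * s) * a1 + 3%:R * r ^+ 2
      - 2%:R * s * t)
    (a6 + r * a4 + r ^+ 2 * a2 + r ^+ 3 - t * a3 - t ^+ 2 - r * t * a1).

Definition pshift (P : option (F * F)) : option (F * F) :=
  if P is Some (x, y) then Some (x + r, y + s * x + t) else None.

Lemma weval_shift W x y : weval (wshift W) x y = weval W (x + r) (y + s * x + t).
Proof. by case: W => a1 a2 a3 a4 a6; rewrite /weval /=; ring. Qed.

Lemma on_curve_shift W P : on_curve W (pshift P) = on_curve (wshift W) P.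
Proof. by case: P => [[x y]|] //=; rewrite /on_curve /= weval_shift. Qed.

Lemma wdisc_shift W : wdisc (wshift W) = wdisc W.
Proof. by case: W => a1 a2 a3 a4 a6; rewrite /wdisc /=; ring. Qed.

Lemma pshift_onto P : exists P0, P = pshift P0.
Proof.
case: P => [[x y]|]; last by exists None.
by exists (Some (x - r, y - s * (x - r) - t)); rewrite /=; congr (Some (_, _)); ring.
Qed.

(** The substitution is affine and preserves vertical lines, hence opposites, chords and tangents;
    every slope grows by [s]. *)
Lemma wadd_shift W P Q : on_curve (wshift W) P -> on_curve (wshift W) Q ->
  wadd W (pshift P) (pshift Q) = pshift (wadd (wshift W) P Q).
Proof.
case: P => [[x1 y1]|]; case: Q => [[x2 y2]|] cP cQ; rewrite ?(wadd0P, waddP0) //.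
have e1 : wa1 (wshift W) = wa1 W + 2%:R * s by case: (W).
have e2 : wa2 (wshift W) = wa2 W - s * wa1 W + 3%:R * r - s ^+ 2 by case: (W).
have e3 : wa3 (wshift W) = wa3 W + r * wa1 W + 2%:R * t by case: (W).
have e4 : wa4 (wshift W) = wa4 W - s * wa3 W + 2%:R * r * wa2 W
    - (t + r * s) * wa1 W + 3%:R * r ^+ 2 - 2%:R * s * t by case: (W).
have [ex|nx] := eqVneq x1 x2; last first.
  have nx' : x2 - x1 != 0 by rewrite subr_eq0 eq_sym.
  pose l := (y2 - y1) / (x2 - x1).
  have el : l * (x2 - x1) = y2 - y1 by rewrite divfK.
  rewrite (wadd_secant _ nx el) /=.
  rewrite (@wadd_secant _ _ (l + s)) ?(inj_eq (addIr _)) //.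
    by rewrite /= e1 e2 e3; congr (Some (_, _)); ring.
  by rewrite mulrDl -[l * _]/(l * _) (_ : x2 + r - _ = x2 - x1) ?el; ring.
subst x2; have [e|ne] := eqVneq (y1 + y2 + wa1 (wshift W) * x1 + wa3 (wshift W)) 0.
  rewrite (wadd_opp e) /= wadd_opp //.
  by rewrite -[RHS]e e1 e3; ring.
have ey : y2 = y1.
  by case: (on_curve_same_x cP cQ) => //= /eqP; rewrite (negbTE ne).
subst y2.
have nM : 2%:R * y1 + wa1 (wshift W) * x1 + wa3 (wshift W) != 0.
  by move: ne; congr (_ != 0); ring.
pose l := (3%:R * x1 ^+ 2 + 2%:R * wa2 (wshift W) * x1 + wa4 (wshift W) - wa1 (wshift W) * y1)
   / (2%:R * y1 + wa1 (wshift W) * x1 + wa3 (wshift W)).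
have el : l * (2%:R * y1 + wa1 (wshift W) * x1 + wa3 (wshift W)) =
  3%:R * x1 ^+ 2 + 2%:R * wa2 (wshift W) * x1 + wa4 (wshift W) - wa1 (wshift W) * y1.
  by rewrite /l divfK.
rewrite (wadd_tangent nM el).
have eM : 2%:R * (y1 + s * x1 + t) + wa1 W * (x1 + r) + wa3 W
    = 2%:R * y1 + wa1 (wshift W) * x1 + wa3 (wshift W).
  by rewrite e1 e3; ring.
rewrite [pshift (Some _)]/= (@wadd_tangent _ _ (l + s)) ?eM //.
  by rewrite /= e1 e2 e3; congr (Some (_, _)); ring.
by rewrite mulrDl el e1 e2 e3 e4; ring.
Qed.

Lemma wassoc_shift W P : on_curve (wshift W) P -> wassoc (wshift W) P ->
  wassoc W (pshift P).
Proof.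
move=> cP aP Q R; have [Q0 ->] := pshift_onto Q; have [R0 ->] := pshift_onto R.
rewrite !on_curve_shift => cQ cR.
by rewrite !wadd_shift ?on_curve_wadd // aP.
Qed.
End Shift.

Section Order.
Variables (F : fieldType) (W : weierstrass F).
Hypothesis (nd : wdisc W != 0).

Lemma wassoc_order2 x y : 2%:R != 0 :> F -> on_curve W (Some (x, y)) ->
  2%:R * y + wa1 W * x + wa3 W = 0 -> wassoc W (Some (x, y)).
Proof.
move=> n2 cT eM.
(* This slope removes [a1]. Moving the point to the origin removes [a6], and order 2 removes [a3],
   which leaves the model of [wassoc_2torsion]. *)
pose s := - wa1 W / 2%:R.
have -> : Some (x, y) = pshift x s y (Some (0, 0)).
  by rewrite /=; congr (Some (_, _)); ring.
apply: wassoc_shift; first by rewrite -(on_curve_shift x s y W) /= mulr0 !add0r.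
set W' := wshift _ _ _ W.
have cT' : weval W' 0 0 = 0.
  by move: cT; rewrite /on_curve weval_shift mulr0 !add0r => /eqP.
have e6 : wa6 W' = 0 by apply/eqP; rewrite -oppr_eq0 -cT' /weval; apply/eqP; ring.
have e3 : wa3 W' = 0 by rewrite -eM /W'; case: (W) => ? ? ? ? ? /=; ring.
have e1 : wa1 W' = 0 by rewrite /W' /s; case: (W) => ? ? ? ? ? /=; field.
have eW : W' = Weierstrass 0 (wa2 W') 0 (wa4 W') 0.
  by case: (W') e1 e3 e6 => /= *; subst.
have := wdisc_shift x s y W; rewrite -/W' eW => ed.
have ed' : 16%:R * wa4 W' ^+ 2 * (wa2 W' ^+ 2 - 4%:R * wa4 W') != 0.
  by move: nd; rewrite -ed; congr (_ != 0); rewrite /wdisc /=; ring.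
move: ed'; rewrite !mulf_eq0 !negb_or => /andP[/andP[_ n4] nd'].
apply: wassoc_2torsion => //.
by case/andP: n4.
Qed.

(** The last hypothesis says that the tangent of slope [l] meets the curve a third time at the point
    itself. With the flex at the origin and its tangent along [y = 0], the right-hand side of the
    equation is reduced to [x^3]. *)
Lemma wshift_flex x y l : on_curve W (Some (x, y)) ->
  l * (2%:R * y + wa1 W * x + wa3 W) =
      3%:R * x ^+ 2 + 2%:R * wa2 W * x + wa4 W - wa1 W * y ->
  l ^+ 2 + wa1 W * l - wa2 W = 3%:R * x ->
  wshift x l y W =
    Weierstrass (wa1 W + 2%:R * l) 0 (2%:R * y + wa1 W * x + wa3 W) 0 0.
Proof.
move=> cT el el2; set W' := wshift _ _ _ W.
have cT' : weval W' 0 0 = 0.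
  by move: cT; rewrite /on_curve weval_shift mulr0 !add0r => /eqP.
have e6 : wa6 W' = 0 by apply/eqP; rewrite -oppr_eq0 -cT' /weval; apply/eqP; ring.
have e1 : wa1 W' = wa1 W + 2%:R * l by rewrite /W'; case: (W).
have e3 : wa3 W' = 2%:R * y + wa1 W * x + wa3 W.
  by rewrite /W'; case: (W) => ? ? ? ? ? /=; ring.
have e4 : wa4 W' = 0.
  apply/subr0_eq; transitivity (3%:R * x ^+ 2 + 2%:R * wa2 W * x + wa4 W
      - wa1 W * y - l * (2%:R * y + wa1 W * x + wa3 W)); last by rewrite el subrr.
  by rewrite /W'; case: (W) => ? ? ? ? ? /=; ring.
have e2 : wa2 W' = 0.
  apply/subr0_eq; transitivity (3%:R * x - (l ^+ 2 + wa1 W * l - wa2 W));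
    last by rewrite el2 subrr.
  by rewrite /W'; case: (W) => ? ? ? ? ? /=; ring.
by rewrite -e1 -e3; case: (W') e2 e4 e6 => /= *; subst.
Qed.

Lemma wassoc_order3 x y l : on_curve W (Some (x, y)) ->
  2%:R * y + wa1 W * x + wa3 W != 0 ->
  l * (2%:R * y + wa1 W * x + wa3 W) =
      3%:R * x ^+ 2 + 2%:R * wa2 W * x + wa4 W - wa1 W * y ->
  l ^+ 2 + wa1 W * l - wa2 W = 3%:R * x ->
  wassoc W (Some (x, y)).
Proof.
move=> cT nM el el2; have eW := wshift_flex cT el el2.
have -> : Some (x, y) = pshift x l y (Some (0, 0)).
  by rewrite /=; congr (Some (_, _)); ring.
apply: wassoc_shift; first by rewrite -(on_curve_shift x l y W) /= mulr0 !add0r.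
have := wdisc_shift x l y W; rewrite eW; move: nM; move: (wa1 W + _) (_ + wa3 W).
move=> a b nb ed; apply: wassoc_3torsion => //.
have : b ^+ 3 * (a ^+ 3 - 27%:R * b) != 0.
  by move: nd; rewrite -ed; congr (_ != 0); rewrite /wdisc /=; ring.
by rewrite mulf_eq0 negb_or => /andP[].
Qed.
End Order.

(** * The commutative monoid of the points that associate with all others *)

Section AssocPoints.
Variables (F : fieldType) (W : weierstrass F).

Definition apoint_pred (P : option (F * F)) : bool :=
  on_curve W P && `[< wassoc W P >].

Record apoint := APoint { apval : option (F * F); _ : apoint_pred apval }.
HB.instance Definition _ := [isSub for apval].
HB.instance Definition _ := [Choice of apoint by <:].

Lemma apoint_on (P : apoint) : on_curve W (val P).
Proof. by case: P => P /= /andP[]. Qed.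

Lemma apoint_assoc (P : apoint) : wassoc W (val P).
Proof. by case: P => P /= /andP[_ /asboolP]. Qed.

Lemma apoint_pred0 : apoint_pred None.
Proof. by apply/andP; split=> //; apply/asboolP. Qed.

Lemma apoint_predD (P Q : apoint) : apoint_pred (wadd W (val P) (val Q)).
Proof.
apply/andP; split; first by rewrite on_curve_wadd ?apoint_on.
apply/asboolP => R S cR cS.
rewrite !(apoint_assoc P) ?(apoint_assoc Q) ?on_curve_wadd ?apoint_on //.
Qed.

Definition ap0 := APoint apoint_pred0.
Definition apadd P Q := APoint (apoint_predD P Q).

Lemma apaddA : associative apadd.
Proof. by move=> P Q R; apply/val_inj; rewrite /= (apoint_assoc P) ?apoint_on. Qed.
Lemma apaddC : commutative apadd.
Proof. by move=> P Q; apply/val_inj; rewrite /= waddC ?apoint_on. Qed.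
Lemma ap0add : left_id ap0 apadd.
Proof. by move=> P; apply/val_inj. Qed.

HB.instance Definition _ := GRing.isNmodule.Build apoint apaddA apaddC ap0add.
End AssocPoints.

(** * Independence of elements of order 2 and 3 in a commutative monoid *)

Section Independence.
Variable M : nmodType.
Implicit Types A B : M.

Lemma mulrn_modn A n k : A *+ n = 0 -> A *+ (k %% n) = A *+ k.
Proof.
by move=> e; rewrite [in RHS](divn_eq k n) mulrnDr mulnC mulrnA e mul0rn add0r.
Qed.

Lemma independent2 A B i j : A *+ 2 = 0 -> B *+ 2 = 0 ->
    A != 0 -> B != 0 -> A != B ->
  A *+ i + B *+ j = 0 -> (2 %| i)%N && (2 %| j)%N.
Proof.
move=> eA eB nA nB nAB; rewrite -(mulrn_modn i eA) -(mulrn_modn j eB) /dvdn.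
have : (i %% 2 < 2)%N && (j %% 2 < 2)%N by rewrite !ltn_mod.
case: (i %% 2)%N => [|[|//]]; case: (j %% 2)%N => [|[|//]] //= _;
  rewrite ?mulr0n ?mulr1n ?addr0 ?add0r => /eqP //; rewrite ?(negbTE nA) ?(negbTE nB) //.
move=> /eqP e; case/eqP: nAB.
by rewrite -[A]addr0 -eB mulr2n addrA e add0r.
Qed.

Lemma independent3 A B i j : A *+ 3 = 0 -> B *+ 3 = 0 ->
    A != 0 -> B != 0 -> A != B -> A + B != 0 ->
  A *+ i + B *+ j = 0 -> (3 %| i)%N && (3 %| j)%N.
Proof.
move=> eA eB nA nB nAB nAB'; rewrite -(mulrn_modn i eA) -(mulrn_modn j eB) /dvdn.
have dbl (C : M) : C *+ 3 = 0 -> C *+ 2 = 0 -> C = 0.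
  by move=> e3 e2; rewrite -e3 (mulrS C 2) e2 addr0.
have : (i %% 3 < 3)%N && (j %% 3 < 3)%N by rewrite !ltn_mod.
case: (i %% 3)%N => [|[|[|//]]]; case: (j %% 3)%N => [|[|[|//]]] //= _;
  rewrite ?mulr0n ?mulr1n ?addr0 ?add0r => /eqP //;
  rewrite ?(negbTE nA) ?(negbTE nB) ?(negbTE nAB') //.
- by move=> /eqP /(dbl _ eB) /eqP; rewrite (negbTE nB).
- move=> /eqP e; case/eqP: nAB.
  by rewrite -[A]addr0 -eB (mulrS B 2) addrCA e addr0.
- by move=> /eqP /(dbl _ eA) /eqP; rewrite (negbTE nA).
- move=> /eqP e; case/eqP: nAB.
  by rewrite -[B]addr0 -eA (mulrS A 2) addrCA [B + _]addrC e addr0.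
- move=> /eqP; rewrite -mulrnDl => /dbl e; case/eqP: nAB'; apply: e.
  by rewrite mulrnDl eA eB addr0.
Qed.
End Independence.

(** * The curves with full 6-torsion *)

Lemma eq_of_dvd6 a b : (a < 6)%N -> (b < 6)%N ->
  (3 %| (a + 5 * b) * 2)%N -> (2 %| (a + 5 * b) * 3)%N -> a = b.
Proof.
by case: a => [|[|[|[|[|[|//]]]]]]; case: b => [|[|[|[|[|[|//]]]]]].
Qed.

(** Two points of order 2 and two flexes suffice: the sums of one of each, [G = A + B] and
    [G' = A' + B'], generate the group. Distinct abscissas of the flexes exclude both [B = B'] and
    [B = - B']. *)
Lemma embeds_Z6 (F : fieldType) (E : elliptic_curve F) xa ya xa' ya' xb yb lb xb' yb' lb' :
  let M x y := 2%:R * y + wa1 E * x + wa3 E in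
  let N x y := 3%:R * x ^+ 2 + 2%:R * wa2 E * x + wa4 E - wa1 E * y in
  2%:R != 0 :> F ->
  on_curve E (Some (xa, ya)) -> on_curve E (Some (xa', ya')) ->
  M xa ya = 0 -> M xa' ya' = 0 -> xa != xa' ->
  on_curve E (Some (xb, yb)) -> on_curve E (Some (xb', yb')) ->
  M xb yb != 0 -> M xb' yb' != 0 -> xb != xb' ->
  lb * M xb yb = N xb yb -> lb' * M xb' yb' = N xb' yb' ->
  lb ^+ 2 + wa1 E * lb - wa2 E = 3%:R * xb ->
  lb' ^+ 2 + wa1 E * lb' - wa2 E = 3%:R * xb' ->
  embeds_in_points ('Z_6 * 'Z_6)%type E.
Proof.
move=> M N n2 ca ca' Ma Ma' nxa cb cb' Mb Mb' nxb eb eb' fb fb'.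
have nd : wdisc E != 0 by case: (E).
pose mk x y (c : on_curve E (Some (x, y))) (a : wassoc E (Some (x, y))) : apoint E :=
  APoint (introT andP (conj c (introT (asboolP _) a))).
pose A := mk _ _ ca (wassoc_order2 nd n2 ca Ma).
pose A' := mk _ _ ca' (wassoc_order2 nd n2 ca' Ma').
pose B := mk _ _ cb (wassoc_order3 nd cb Mb eb fb).
pose B' := mk _ _ cb' (wassoc_order3 nd cb' Mb' eb' fb').
have ord2 x y c a : M x y = 0 -> mk x y c a *+ 2 = 0.
  by move=> e; apply/val_inj; rewrite mulr2n /= wadd_opp // -e /M; ring.
have ord3 x y l c a : M x y != 0 -> l * M x y = N x y ->
    l ^+ 2 + wa1 E * l - wa2 E = 3%:R * x -> mk x y c a *+ 3 = 0.
  move=> nM el fl; apply/val_inj; rewrite mulrS mulr2n /=.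
  rewrite (wadd_tangent nM el) /= fl.
  rewrite (_ : 3%:R * x - x - x = x); last by ring.
  by rewrite wadd_opp //; ring.
have A2 : A *+ 2 = 0 by apply: ord2.
have A'2 : A' *+ 2 = 0 by apply: ord2.
have B3 : B *+ 3 = 0 by apply: (ord3 _ _ lb).
have B'3 : B' *+ 3 = 0 by apply: (ord3 _ _ lb').
have nA : A != 0 by [].
have nA' : A' != 0 by [].
have nB : B != 0 by [].
have nB' : B' != 0 by [].
have nAA : A != A' by apply: contraNneq nxa => /(congr1 val) [->].
have nBB : B != B' by apply: contraNneq nxb => /(congr1 val) [->].
have nBB' : B + B' != 0.
  by apply/eqP => /(congr1 val); rewrite /= /wadd (negbTE nxb).
pose G := A + B; pose G' := A' + B'.
(* Tripling keeps only the part of order 2, doubling only the part of order 3. *)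
have mul6 (C D : apoint E) n : C *+ 2 = 0 -> D *+ 3 = 0 ->
    ((C + D) *+ n *+ 3 = C *+ (n * 3)) * ((C + D) *+ n *+ 2 = D *+ (n * 2))
     * ((C + D) *+ 6 = 0).
  move=> eC eD; rewrite -!mulrnA !mulrnDl; do !split.
  - by rewrite [X in _ + X](_ : _ = 0) ?addr0 // mulnC mulrnA eD mul0rn.
  - by rewrite [X in X + _](_ : _ = 0) ?add0r // mulnC mulrnA eC mul0rn.
  - by rewrite (mulrnA C 2 3) eC (mulrnA D 3 2) eD !mul0rn addr0.
pose g (u : 'Z_6 * 'Z_6) := G *+ u.1 + G' *+ u.2.
have gD u v : g (u + v) = g u + g v.
  rewrite /g /= (mulrn_modn _ (mul6 _ _ 0%N A2 B3).2) (mulrn_modn _ (mul6 _ _ 0%N A'2 B'3).2).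
  by rewrite !mulrnDr addrACA.
have gI : injective g.
  move=> u v euv; have e : G *+ (u.1 + 5 * v.1) + G' *+ (u.2 + 5 * v.2) = 0.
    have h (C : apoint E) n : C *+ 6 = 0 -> C *+ n + C *+ (5 * n) = 0.
      by move=> eC; rewrite -mulrnDr -mulSn mulrnA eC mul0rn.
    rewrite (mulrnDr G u.1) (mulrnDr G' u.2) addrACA -/(g u) euv /g addrACA.
    by rewrite !h ?addr0 // ?(mul6 _ _ 0%N A2 B3) ?(mul6 _ _ 0%N A'2 B'3).
  set n := (u.1 + _)%N in e; set m := (u.2 + _)%N in e.
  have : G *+ n *+ 3 + G' *+ m *+ 3 = 0 by rewrite -mulrnDl e mul0rn.
  have : G *+ n *+ 2 + G' *+ m *+ 2 = 0 by rewrite -mulrnDl e mul0rn.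
  rewrite !(mul6 _ _ _ A2 B3) !(mul6 _ _ _ A'2 B'3) {e}/n {}/m.
  move=> /(independent3 B3 B'3 nB nB' nBB nBB') /andP[d1 d2].
  move=> /(independent2 A2 A'2 nA nA' nAA) /andP[d3 d4].
  case: u v {euv} d1 d2 d3 d4 => [u1 u2] [v1 v2] d1 d2 d3 d4.
  by congr (_, _); apply/val_inj; apply: eq_of_dvd6;
    rewrite ?(ltn_ord u1) ?(ltn_ord u2) ?(ltn_ord v1) ?(ltn_ord v2).
exists (fun u => exist _ (val (g u)) (apoint_on (g u))); split.
  by move=> u v [] e; apply/gI/val_inj.
by move=> u v; apply/val_inj; exact: (congr1 val (gD u v)).
Qed.

(** * The family [E_t], a Weierstrass form of the Hesse pencil *)

Section HesseCurve.
Variables (F : fieldType) (t : F).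
Hypotheses (n2 : 2%:R != 0 :> F) (n3 : 3%:R != 0 :> F) (nt : t ^+ 3 != 1).

Definition hesse_model : weierstrass F :=
  Weierstrass (3%:R * t) 0 (t ^+ 3 - 1) 0 0.

Lemma wdisc_hesse : wdisc hesse_model = 27%:R * (t ^+ 3 - 1) ^+ 3.
Proof. by rewrite /wdisc /=; ring. Qed.

Lemma hesse_nonsingular : wdisc hesse_model != 0.
Proof.
by rewrite wdisc_hesse (natrM _ 3 9) (natrM _ 3 3) !mulf_neq0 // subr_eq0.
Qed.

Definition hesse_curve := EllipticCurve hesse_nonsingular.

(** At a point of order 2 the equation reads [- y^2 = x^3], so the point is [(- g^2, - g^3)] for
    some [g]. The remaining condition on [g] becomes this cubic after [g = Z / 2 - t]. *)
Let cubic Z := Z ^+ 3 - 3%:R * t * Z ^+ 2 + 4%:R.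

Lemma hesse_embeds (w Z1 Z2 : F) : w ^+ 2 + w + 1 = 0 ->
  Z1 != Z2 -> cubic Z1 = 0 -> cubic Z2 = 0 ->
  embeds_in_points ('Z_6 * 'Z_6)%type hesse_curve.
Proof.
move=> ew nZ e1 e2.
pose g Z := Z / 2%:R - t.
have eg Z : cubic Z = 0 -> 2%:R * - (g Z) ^+ 3 + 3%:R * t * - (g Z) ^+ 2 + (t ^+ 3 - 1) = 0.
  move=> e; transitivity (- cubic Z / 4%:R); last by rewrite e oppr0 mul0r.
  by rewrite /cubic /g; field; rewrite (natrM _ 2 2) mulf_neq0.
have ong Z : cubic Z = 0 -> on_curve hesse_curve (Some (- (g Z) ^+ 2, - (g Z) ^+ 3)).
  move=> e; apply/eqP; rewrite /weval /=.
  transitivity (- (g Z) ^+ 3 * (2%:R * - (g Z) ^+ 3 + 3%:R * t * - (g Z) ^+ 2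
    + (t ^+ 3 - 1))); first by ring.
  by rewrite eg ?mulr0.
have nt1 : t - 1 != 0 by rewrite subr_eq0; apply: contraNneq nt => ->; rewrite expr1n.
have ew3 : w ^+ 3 = 1.
  by apply/subr0_eq; transitivity ((w - 1) * (w ^+ 2 + w + 1)); [ring | rewrite ew mulr0].
have ntw : t - w != 0 by rewrite subr_eq0; apply: contraNneq nt => ->; rewrite ew3.
have nw1 : w - 1 != 0.
  rewrite subr_eq0; apply: contraNneq n3 => w1.
  by apply/eqP; rewrite -ew w1; ring.
have eM : 2%:R * ((t - 1) ^+ 2 * (t - w)) + 3%:R * t * - ((t - 1) * (t - w)) + (t ^+ 3 - 1)
    = (t - 1) * (t - w) * (w - 1).
  transitivity ((t - 1) * (t - w) * (w - 1) + (t - 1) * (w ^+ 2 + w + 1)); first by ring.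
  by rewrite ew mulr0 addr0.
(* The flexes are the origin, with tangent slope 0, and a second one defined by the cube root of
   unity [w], with tangent slope [(w - 1) (t - 1)]. *)
apply: (@embeds_Z6 _ _ (- (g Z1) ^+ 2) (- (g Z1) ^+ 3) (- (g Z2) ^+ 2) (- (g Z2) ^+ 3)
  0 0 0 (- ((t - 1) * (t - w))) ((t - 1) ^+ 2 * (t - w)) ((w - 1) * (t - 1))) => //=.
- exact: ong.
- exact: ong.
- exact: eg.
- exact: eg.
- rewrite eqr_opp eqf_sqr negb_or; apply/andP; split.
    by rewrite /g (inj_eq (addIr _)) (inj_eq (mulIf _)) // invr_eq0.
  (* If [g Z1 = - g Z2], subtracting the two cubics leaves a quadratic equation for [Z2]; [Z2 + t]
     times that quadratic differs from [cubic Z2] by [4 (t^3 - 1)]. *)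
  apply: contraNneq nt => eZ; apply/eqP/subr0_eq.
  have es : Z1 = 4%:R * t - Z2.
    apply: (mulIf (x := 2%:R^-1)); first by rewrite invr_eq0.
    rewrite -[LHS](subrK t) -/(g Z1) eZ /g; field.
    by [].
  have d : (Z2 - Z1) * (Z2 ^+ 2 - 4%:R * t * Z2 + 4%:R * t ^+ 2) = 0.
    by transitivity (cubic Z2 - cubic Z1); [rewrite /cubic es; ring | rewrite e1 e2 subrr].
  move/eqP: d; rewrite mulf_eq0 subr_eq0 eq_sym (negbTE nZ) /= => /eqP d.
  have n4 : 4%:R != 0 :> F by rewrite (natrM _ 2 2) mulf_neq0.
  apply: (mulfI n4); rewrite mulr0.
  transitivity ((Z2 + t) * (Z2 ^+ 2 - 4%:R * t * Z2 + 4%:R * t ^+ 2) - cubic Z2).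
    by rewrite /cubic; ring.
  by rewrite d e2 mulr0 subrr.
- by apply/eqP; rewrite /weval /=; ring.
- apply/eqP; rewrite /weval /=.
  transitivity ((t - 1) ^+ 3 * (t - w) * (w ^+ 2 + w + 1)); first by ring.
  by rewrite ew mulr0.
- by rewrite !mulr0 !add0r subr_eq0.
- by rewrite eM !mulf_neq0.
- by rewrite eq_sym oppr_eq0 mulf_neq0.
- by ring.
- rewrite eM; apply/subr0_eq.
  transitivity ((t - 1) ^+ 2 * (t - w) * (w ^+ 2 + w + 1)); first by ring.
  by rewrite ew mulr0.
- by ring.
- apply/subr0_eq; transitivity ((t - 1) ^+ 2 * (w ^+ 2 + w + 1)); first by ring.
  by rewrite ew mulr0.
Qed.
End HesseCurve.

(** * From a curve to a point of X(6) *)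

Section ExtractModularPoint.
Variables (F : fieldType) (E : elliptic_curve F).
Hypotheses (n2 : 2%:R != 0 :> F) (n3 : 3%:R != 0 :> F).

Let M x y := 2%:R * y + wa1 E * x + wa3 E.

(** It yields [f 0 = None] for an additive [f] without any cancellation law. If [2P = P], the
    tangent at [P] has its third intersection at [P], so [2P = - P] as well, and [P = - P]
    contradicts [2P] being affine. *)
Lemma wadd_idem P : on_curve E P -> wadd E P P = P -> P = None.
Proof.
case: P => [[x y]|] // cP; have [e|ne] := eqVneq (M x y) 0.
  by rewrite wadd_opp // -e /M; ring.
rewrite (wadd_tangent ne (divfK ne _)) /= => [[ex ey]].
by case/eqP: ne; rewrite /M; move: ey; rewrite ex subrr mulr0 addr0 => e;
  transitivity (y - (- y - wa1 E * x - wa3 E)); [ring | rewrite e subrr].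
Qed.

Lemma torsion2P x y : wadd E (Some (x, y)) (Some (x, y)) = None -> M x y = 0.
Proof.
rewrite /wadd eqxx /=; case: eqP => // e _; rewrite /M.
by transitivity (y - (- y - wa1 E * x - wa3 E)); [ring | rewrite -e subrr].
Qed.

Lemma torsion3P x y x3 y3 : wadd E (Some (x, y)) (Some (x, y)) = Some (x3, y3) ->
  wadd E (Some (x3, y3)) (Some (x, y)) = None ->
  exists l, [/\ M x y != 0,
    l * M x y = 3%:R * x ^+ 2 + 2%:R * wa2 E * x + wa4 E - wa1 E * y &
    l ^+ 2 + wa1 E * l - wa2 E = 3%:R * x].
Proof.
have [e|ne] := eqVneq (M x y) 0; first by rewrite wadd_opp // -e /M; ring.
rewrite (wadd_tangent ne (divfK ne _)) /=; set l := _ / _ => [[ex _]].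
rewrite /wadd; case: (eqVneq x3 x) => //= ex3; case: eqP => // _ _.
exists l; split=> //; first by rewrite divfK.
by apply/subr0_eq; rewrite -[RHS](subrr x) -{2}ex3 -ex; ring.
Qed.

(** Given the root [X1], the two others are those of [Z^2 - (4 / X1^2) Z - 4 / X1], whose
    discriminant is [16 (X1^3 + 1) / X1^4]. It is a square as they lie in [F]; it vanishes if
    [X1^3 = - 1], while [X1^3 = 8] makes [X1] a double root. *)
Lemma modular_point_roots (t X1 X2 X3 : F) :
  (forall X, X \in [:: X1; X2; X3] -> X ^+ 3 - 3%:R * t * X ^+ 2 + 4%:R = 0) ->
  X1 != X2 -> X1 != X3 -> X2 != X3 ->
  exists X Y : F, [/\ Y ^+ 2 = X ^+ 3 + 1, X != 0, X ^+ 3 != - 1 & X ^+ 3 != 8%:R].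
Proof.
move=> h n12 n13 n23.
have n4 : 4%:R != 0 :> F by rewrite (natrM _ 2 2) mulf_neq0.
have n16 : 16%:R != 0 :> F by rewrite (natrM _ 4 4) mulf_neq0.
have h1 : X1 ^+ 3 - 3%:R * t * X1 ^+ 2 + 4%:R = 0 by apply: h; rewrite !inE eqxx.
have h2 : X2 ^+ 3 - 3%:R * t * X2 ^+ 2 + 4%:R = 0 by apply: h; rewrite !inE eqxx ?orbT.
have h3 : X3 ^+ 3 - 3%:R * t * X3 ^+ 2 + 4%:R = 0 by apply: h; rewrite !inE eqxx ?orbT.
have q U V : U != V -> U ^+ 3 - 3%:R * t * U ^+ 2 + 4%:R = 0 ->
    V ^+ 3 - 3%:R * t * V ^+ 2 + 4%:R = 0 ->
    U ^+ 2 + U * V + V ^+ 2 - 3%:R * t * (U + V) = 0.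
  move=> nUV eU eV; have nUV' : U - V != 0 by rewrite subr_eq0.
  apply: (mulfI nUV'); rewrite mulr0 -(subrr 0) -{1}eU -eV; ring.
have q2 := q _ _ n12 h1 h2; have q3 := q _ _ n13 h1 h3.
have d23 : X2 - X3 != 0 by rewrite subr_eq0.
have es : X1 + X2 + X3 - 3%:R * t = 0.
  by apply: (mulfI d23); rewrite mulr0 -(subrr 0) -{1}q2 -q3; ring.
have e2 : X1 * (X2 + X3) + X2 * X3 = 0.
  transitivity ((X1 + X2) * (X1 + X2 + X3 - 3%:R * t)
    - (X1 ^+ 2 + X1 * X2 + X2 ^+ 2 - 3%:R * t * (X1 + X2))
    + 0); last by rewrite es q2; ring.
  ring.
have e3 : X1 * (X2 * X3) = - 4%:R.
  apply/subr0_eq; transitivity (- (X1 ^+ 2 * (X1 + X2 + X3 - 3%:R * t))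
    + X1 * (X1 * (X2 + X3) + X2 * X3)
    + (X1 ^+ 3 - 3%:R * t * X1 ^+ 2 + 4%:R)); last by rewrite es e2 h1; ring.
  ring.
have nX : X1 != 0.
  by apply: contraNneq n4 => X0; rewrite -oppr_eq0 -e3 X0 mul0r.
have e4 : X1 ^+ 2 * (X2 + X3) = 4%:R.
  apply/subr0_eq; transitivity (X1 * (X1 * (X2 + X3) + X2 * X3) - (X1 * (X2 * X3) + 4%:R)).
    by ring.
  by rewrite e2 e3; ring.
pose Y := X1 ^+ 2 * (X2 - X3) / 4%:R.
have eY : Y ^+ 2 = X1 ^+ 3 + 1.
  transitivity (((X1 ^+ 2 * (X2 + X3)) ^+ 2 - 4%:R * X1 ^+ 3 * (X1 * (X2 * X3))) / 4%:R ^+ 2).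
    by rewrite /Y; field; nonzero.
  by rewrite e4 e3; field; nonzero.
have nY : Y != 0 by rewrite mulf_neq0 ?invr_eq0 // mulf_neq0 // expf_neq0.
exists X1, Y; split=> //.
  by apply: contraNneq nY => e; rewrite -sqrf_eq0 eY e addNr.
have n8 : X1 * ((X2 - X1) * (X3 - X1)) != 0.
  by rewrite !mulf_neq0 // subr_eq0 eq_sym.
apply: contraNneq n8 => e; apply/eqP.
transitivity (X1 * (X2 * X3) - X1 ^+ 2 * (X2 + X3) + X1 ^+ 3); first by ring.
by rewrite e3 e4 e; ring.
Qed.

(* Here (0,0) and (x, y) are independent points of order 3 on the curve
   [y^2 + a x y + b y = x^3], and e1, e2, e3 the abscissas of its points of order 2. *)
Lemma modular_point_flex (a b x y l e1 e2 e3 : F) :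
  b != 0 -> x != 0 -> y ^+ 2 + a * x * y + b * y = x ^+ 3 ->
  2%:R * y + a * x + b != 0 ->
  l * (2%:R * y + a * x + b) = 3%:R * x ^+ 2 - a * y ->
  l ^+ 2 + a * l = 3%:R * x ->
  (forall e, e \in [:: e1; e2; e3] -> 4%:R * e ^+ 3 + (a * e + b) ^+ 2 = 0) ->
  e1 != e2 -> e1 != e3 -> e2 != e3 ->
  exists r X Y : F, [/\ r ^+ 2 = - 3%:R, Y ^+ 2 = X ^+ 3 + 1, X != 0,
    X ^+ 3 != - 1 & X ^+ 3 != 8%:R].
Proof.
move=> nb nx cQ; set m := 2%:R * y + a * x + b => nm el el2 he n12 n13 n23.
have f0 : y ^+ 2 + a * x * y + b * y - x ^+ 3 = 0 by rewrite cQ subrr.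
(* This is the 3-division polynomial divided by its factor [x], which belongs to the flex at the
   origin. *)
have eS : 3%:R * x ^+ 3 + a ^+ 2 * x ^+ 2 + 3%:R * a * b * x + 3%:R * b ^+ 2 = 0.
  apply: (mulfI nx); rewrite mulr0.
  transitivity (- ((3%:R * x ^+ 2 - a * y) ^+ 2 + a * (3%:R * x ^+ 2 - a * y) * m
      - 3%:R * x * m ^+ 2) - (a ^+ 2 + 12%:R * x) * (y ^+ 2 + a * x * y + b * y - x ^+ 3)).
    by rewrite /m; ring.
  rewrite f0 -el; transitivity (m ^+ 2 * (3%:R * x - (l ^+ 2 + a * l))); first by ring.
  by rewrite el2; ring.
(* On the curve [m^2 = 4 x^3 + (a x + b)^2], so [(a x + 3 b)^2 + 3 m^2] is four times the cubic of
   [eS]. This makes explicit the root of unity that the Weil pairing predicts. *)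
pose r := (a * x + 3%:R * b) / m.
have er : r ^+ 2 = - 3%:R.
  apply/subr0_eq; transitivity (((a * x + 3%:R * b) ^+ 2 + 3%:R * m ^+ 2) / m ^+ 2).
    by rewrite /r; field; nonzero.
  have -> : (a * x + 3%:R * b) ^+ 2 + 3%:R * m ^+ 2 =
     4%:R * (3%:R * x ^+ 3 + a ^+ 2 * x ^+ 2 + 3%:R * a * b * x + 3%:R * b ^+ 2)
     + 12%:R * (y ^+ 2 + a * x * y + b * y - x ^+ 3) by rewrite /m; ring.
  by rewrite eS f0 !mulr0 addr0 mul0r.
(* The parameter of the Hesse pencil is [t = a / c], with 27 b = a^3 - c^3. *)
pose c := a + 3%:R * y / x.
have ec : c ^+ 3 = a ^+ 3 - 27%:R * b.
  apply/subr0_eq; transitivity (((a * x + 3%:R * y) ^+ 3 - a ^+ 3 * x ^+ 3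
      + 27%:R * b * x ^+ 3) / x ^+ 3); first by rewrite /c; field; nonzero.
  set S := (X in X / _); have -> : S =
    9%:R * y * (3%:R * x ^+ 3 + a ^+ 2 * x ^+ 2 + 3%:R * a * b * x + 3%:R * b ^+ 2)
    + (27%:R * y - 27%:R * b) * (y ^+ 2 + a * x * y + b * y - x ^+ 3).
    by rewrite /S; ring.
  by rewrite eS f0 !mulr0 addr0 mul0r.
(* A homography taking the 2-division cubic [4 e^3 + (a e + b)^2] to [V^3 - 3 a V^2 + 4 c^3], which
   is the cubic of [modular_point_roots] for [V / c] and [t = a / c]. *)
pose V e := - (3%:R * b / e + a).
have ne e : e \in [:: e1; e2; e3] -> e != 0.
  move=> /he h; apply: contraNneq nb => e0; rewrite -sqrf_eq0 -h e0; apply/eqP; ring.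
have hV e : e \in [:: e1; e2; e3] -> V e ^+ 3 - 3%:R * a * V e ^+ 2 + 4%:R * c ^+ 3 = 0.
  move=> ie; have n0 := ne _ ie; rewrite ec.
  transitivity (- 27%:R * b * (4%:R * e ^+ 3 + (a * e + b) ^+ 2) / e ^+ 3).
    by rewrite /V; field; nonzero.
  by rewrite he // mulr0 mul0r.
have i1 : e1 \in [:: e1; e2; e3] by rewrite !inE eqxx.
have i2 : e2 \in [:: e1; e2; e3] by rewrite !inE eqxx orbT.
have i3 : e3 \in [:: e1; e2; e3] by rewrite !inE eqxx !orbT.
have nV e e' : e \in [:: e1; e2; e3] -> e' \in [:: e1; e2; e3] -> e != e' ->
    V e != V e'.
  move=> ie ie'; apply: contraNneq => eV.
  have : 3%:R * b * (e' - e) = 0.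
    by transitivity (e * e' * (V e' - V e)); [rewrite /V; field; rewrite !ne | rewrite eV; ring].
  by move/eqP; rewrite !mulf_eq0 (negbTE n3) (negbTE nb) subr_eq0 eq_sym.
(* For [c = 0] the cubic has only the roots [0] and [3 a], too few for three distinct values. *)
have nc : c != 0.
  apply/negP => /eqP c0.
  have hV' e : e \in [:: e1; e2; e3] -> V e = 0 \/ V e = 3%:R * a.
    move=> /hV; rewrite c0 => h.
    have : V e ^+ 2 * (V e - 3%:R * a) = 0 by rewrite -h; ring.
    by move/eqP; rewrite mulf_eq0 sqrf_eq0 subr_eq0 => /orP[] /eqP; [left | right].
  have := nV _ _ i1 i2 n12; have := nV _ _ i1 i3 n13; have := nV _ _ i2 i3 n23.
  by case: (hV' _ i1) => ->; case: (hV' _ i2) => ->; case: (hV' _ i3) => ->; rewrite eqxx.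
have [|||| X [Y [eY nX nX1 nX8]]] := @modular_point_roots (a / c) (V e1 / c) (V e2 / c) (V e3 / c).
- suff h e : e \in [:: e1; e2; e3] ->
    (V e / c) ^+ 3 - 3%:R * (a / c) * (V e / c) ^+ 2 + 4%:R = 0.
    by move=> X; rewrite !inE => /or3P[] /eqP ->; apply: h.
  move=> ie; transitivity ((V e ^+ 3 - 3%:R * a * V e ^+ 2 + 4%:R * c ^+ 3) / c ^+ 3).
    by field; nonzero.
  by rewrite hV // mul0r.
- by rewrite (inj_eq (mulIf _)) ?invr_eq0 ?nV.
- by rewrite (inj_eq (mulIf _)) ?invr_eq0 ?nV.
- by rewrite (inj_eq (mulIf _)) ?invr_eq0 ?nV.
by exists r, X, Y.
Qed.
End ExtractModularPoint.

(** The images of [(2, 0)] and [(0, 2)] are independent flexes, those of [(3, 0)], [(0, 3)],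
    [(3, 3)] the points of order 2. Moving the first flex to the origin brings the curve to the form
    of [modular_point_flex]. *)
Lemma modular_point_of_embedding (F : fieldType) (E : elliptic_curve F) :
  2%:R != 0 :> F -> 3%:R != 0 :> F ->
  embeds_in_points ('Z_6 * 'Z_6)%type E ->
  exists r X Y : F, [/\ r ^+ 2 = - 3%:R, Y ^+ 2 = X ^+ 3 + 1, X != 0,
    X ^+ 3 != - 1 & X ^+ 3 != 8%:R].
Proof.
move=> n2 n3 [f [fI fD]].
have {}fD u v : val (f (u + v)) = wadd E (val (f u)) (val (f v)) by rewrite fD.
have fon u : on_curve E (val (f u)) := valP (f u).
have f0 : val (f 0) = None.
  by apply: (wadd_idem (E := E)) => //; rewrite -fD addr0.
have {}fI u v : val (f u) = val (f v) -> u = v by move/val_inj/fI.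
have fS u : u != 0 -> exists x y, val (f u) = Some (x, y).
  move=> nu; case e: (val (f u)) => [[x y]|]; first by exists x, y.
  by case/eqP: nu; apply: fI; rewrite e f0.
pose p i j : 'Z_6 * 'Z_6 := (inZp i, inZp j).
have flex u : u != 0 -> u + u != 0 -> u + u + u = 0 ->
    exists x y l, [/\ val (f u) = Some (x, y), 2%:R * y + wa1 E * x + wa3 E != 0,
    l * (2%:R * y + wa1 E * x + wa3 E) =
      3%:R * x ^+ 2 + 2%:R * wa2 E * x + wa4 E - wa1 E * y &
    l ^+ 2 + wa1 E * l - wa2 E = 3%:R * x].
  move=> /fS[x [y e]] /fS[x3 [y3 e3]] u3.
  have h3 := fD u u; rewrite e e3 in h3.
  have h0 := fD (u + u) u; rewrite u3 f0 e e3 in h0.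
  by have [l [h1 h2 h4]] := torsion3P (esym h3) (esym h0); exists x, y, l.
have half u : u != 0 -> u + u = 0 -> exists x y, val (f u) = Some (x, y) /\
    2%:R * y + wa1 E * x + wa3 E = 0.
  move=> /fS[x [y e]] u2; exists x, y; split=> //.
  by have := fD u u; rewrite u2 f0 e => /esym /torsion2P.
have [|||x1 [y1 [l1 [v1 nM1 el1 fl1]]]] := flex (p 2 0) => //.
  by apply/eqP.
have [|||x2 [y2 [l2 [v2 nM2 el2 fl2]]]] := flex (p 0 2) => //.
  by apply/eqP.
have [||e1 [h1 [w1 t1]]] := half (p 3 0) => //; first by apply/eqP.
have [||e2 [h2 [w2 t2]]] := half (p 0 3) => //; first by apply/eqP.
have [||e3 [h3 [w3 t3]]] := half (p 3 3) => //; first by apply/eqP.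
have c1 := fon (p 2 0); rewrite v1 in c1.
have c2 := fon (p 0 2); rewrite v2 in c2.
(* Equal abscissas would make the two flexes equal or opposite, against injectivity. *)
have nx : x2 - x1 != 0.
  rewrite subr_eq0; apply/eqP => ex; rewrite ex in v2 c2.
  case: (on_curve_same_x c1 c2) => [ey|e0].
    by have := fI (p 2 0) (p 0 2); rewrite v1 v2 ey => /(_ erefl) /eqP.
  have := fD (p 2 0) (p 0 2); rewrite v1 v2 wadd_opp // -f0 => /fI /eqP.
  by [].
have dist u v a b a' b' : val (f u) = Some (a, b) -> val (f v) = Some (a', b') ->
    2%:R * b + wa1 E * a + wa3 E = 0 -> 2%:R * b' + wa1 E * a' + wa3 E = 0 ->
    u != v -> a - x1 != a' - x1.
  move=> hu hv eb eb' nuv; rewrite (inj_eq (addIr _)); apply: contraNneq nuv => ea.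
  apply/eqP/fI; rewrite hu hv ea; congr (Some (_, _)); apply: (mulfI n2).
  by apply/subr0_eq; rewrite -(subrr 0) -{1}eb -eb' ea; ring.
have eW := wshift_flex c1 el1 fl1; set W' := wshift _ _ _ _ in eW.
have ev (x y : F) : weval W' (x - x1) (y - y1 - l1 * (x - x1)) = weval E x y.
  by rewrite weval_shift; congr weval; ring.
have a2 : wa2 E - l1 * wa1 E + 3%:R * x1 - l1 ^+ 2 = 0.
  by transitivity (wa2 W'); [rewrite /W'; case: (model E) | rewrite eW].
have a4 : wa4 E - l1 * wa3 E + 2%:R * x1 * wa2 E - (y1 + x1 * l1) * wa1 E
    + 3%:R * x1 ^+ 2 - 2%:R * l1 * y1 = 0.
  by transitivity (wa4 W'); [rewrite /W'; case: (model E) | rewrite eW].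
apply: (@modular_point_flex F n2 n3 (wa1 E + 2%:R * l1) (2%:R * y1 + wa1 E * x1 + wa3 E)
  (x2 - x1) (y2 - y1 - l1 * (x2 - x1)) (l2 - l1) (e1 - x1) (e2 - x1) (e3 - x1)) => //.
- have := ev x2 y2; move/eqP: c2 => ->; rewrite eW /weval /= => h.
  by apply/subr0_eq; rewrite -h; ring.
- by move: nM2; congr (_ != 0); ring.
- transitivity ((l2 - l1) * (2%:R * y2 + wa1 E * x2 + wa3 E)); first by ring.
  rewrite mulrBl el2; apply/subr0_eq.
  transitivity (2%:R * (wa2 E - l1 * wa1 E + 3%:R * x1 - l1 ^+ 2) * (x2 - x1) +
   (wa4 E - l1 * wa3 E + 2%:R * x1 * wa2 E - (y1 + x1 * l1) * wa1 E
    + 3%:R * x1 ^+ 2 - 2%:R * l1 * y1)); last by rewrite a2 a4; ring.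
  by ring.
- apply/subr0_eq; transitivity ((l2 ^+ 2 + wa1 E * l2 - wa2 E - 3%:R * x2)
    + (wa2 E - l1 * wa1 E + 3%:R * x1 - l1 ^+ 2)); first by ring.
  by rewrite fl2 a2 subrr addr0.
- suff h e g : on_curve E (Some (e, g)) -> 2%:R * g + wa1 E * e + wa3 E = 0 ->
    4%:R * (e - x1) ^+ 3 + ((wa1 E + 2%:R * l1) * (e - x1)
      + (2%:R * y1 + wa1 E * x1 + wa3 E)) ^+ 2 = 0.
    move=> e; rewrite !inE => /or3P[] /eqP ->.
    + by apply: (h _ h1) => //; rewrite -w1 fon.
    + by apply: (h _ h2) => //; rewrite -w2 fon.
    + by apply: (h _ h3) => //; rewrite -w3 fon.
  move=> /eqP ce eg; have := ev e g; rewrite ce eW /weval /= => hh.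
  transitivity (- 4%:R * 0 + (2%:R * g + wa1 E * e + wa3 E) ^+ 2 : F); last by rewrite eg; ring.
  by rewrite -hh; ring.
- exact: (dist (p 3 0) (p 0 3) _ h1 _ h2).
- exact: (dist (p 3 0) (p 3 3) _ h1 _ h3).
- exact: (dist (p 0 3) (p 3 3) _ h2 _ h3).
Qed.

(** * Finiteness of the fibres of the j-invariant *)

Section JInvariant.
Variable F : fieldType.
Implicit Type W : weierstrass F.

(** The classical invariant [c4]; the j-invariant is [wc4 W ^+ 3 / wdisc W]. *)
Definition wc4 W : F :=
  (wa1 W ^+ 2 + 4%:R * wa2 W) ^+ 2 - 24%:R * (2%:R * wa4 W + wa1 W * wa3 W).

Lemma wc4_shift r s t W : wc4 (wshift r s t W) = wc4 W.
Proof. by case: W => a1 a2 a3 a4 a6; rewrite /wc4 /=; ring. Qed.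

Lemma weierstrass_iso_j W W' : 2%:R != 0 :> F -> weierstrass_iso W W' ->
  wc4 W ^+ 3 * wdisc W' = wc4 W' ^+ 3 * wdisc W.
Proof.
move=> n2 [u [r [s [t [nu h]]]]].
rewrite -(wc4_shift r s t W) -(wdisc_shift r s t W).
have {}h x y : weval (wshift r s t W) (u ^+ 2 * x) (u ^+ 3 * y) = u ^+ 6 * weval W' x y.
  by rewrite -h weval_shift; congr weval; ring.
move: (wshift r s t W) h => {r s t}W h.
case: W h => b1 b2 b3 b4 b6; case: W' => a1 a2 a3 a4 a6; rewrite /weval /= => h.
(* The terms [y^2] and [x^3] cancel in the hypothesis. The other coefficients are isolated by
   evaluating the difference [G] at [x] in [{-1, 0, 1}] and [y] in [{0, 1}], which gives
   [b_i = u^i a_i]. *)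
pose G x y := b1 * (u ^+ 5 * x * y) + b3 * (u ^+ 3 * y) - b2 * (u ^+ 4 * x ^+ 2)
  - b4 * (u ^+ 2 * x) - b6 - u ^+ 6 * (a1 * x * y + a3 * y - a2 * x ^+ 2 - a4 * x - a6).
have {h} G0 x y : G x y = 0.
  transitivity ((u ^+ 3 * y) ^+ 2 + b1 * (u ^+ 2 * x) * (u ^+ 3 * y) + b3 * (u ^+ 3 * y)
     - ((u ^+ 2 * x) ^+ 3 + b2 * (u ^+ 2 * x) ^+ 2 + b4 * (u ^+ 2 * x) + b6)
     - u ^+ 6 * (y ^+ 2 + a1 * x * y + a3 * y - (x ^+ 3 + a2 * x ^+ 2 + a4 * x + a6))).
    by rewrite /G; ring.
  by rewrite h subrr.
have e6 : b6 = u ^+ 6 * a6.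
  by apply/esym/subr0_eq; transitivity (G 0 0); [rewrite /G; ring | exact: G0].
have e3 : b3 = u ^+ 3 * a3.
  apply: (mulfI (expf_neq0 3 nu)); apply/subr0_eq.
  by transitivity (G 0 1 - G 0 0); [rewrite /G; ring | rewrite !G0 subrr].
have e2 : b2 = u ^+ 2 * a2.
  apply: (mulfI (expf_neq0 4 nu)); apply: (mulfI n2); apply/esym/subr0_eq.
  transitivity (G 1 0 + G (- 1) 0 - G 0 0 - G 0 0); first by rewrite /G; ring.
  by rewrite !G0 !subr0 addr0.
have e4 : b4 = u ^+ 4 * a4.
  apply: (mulfI (expf_neq0 2 nu)); apply: (mulfI n2); apply/esym/subr0_eq.
  transitivity (G 1 0 - G (- 1) 0); first by rewrite /G; ring.
  by rewrite !G0 subrr.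
have e1 : b1 = u * a1.
  apply: (mulfI (expf_neq0 5 nu)); apply/subr0_eq.
  transitivity (G 1 1 - G 1 0 - G 0 1 + G 0 0); first by rewrite /G; ring.
  by rewrite !G0 !subr0 addr0.
by rewrite /wc4 /wdisc /= e1 e2 e3 e4 e6; ring.
Qed.
End JInvariant.

Lemma finite_poly_roots (F : fieldType) (p : {poly F}) : p != 0 ->
  finite_set [set x | p.[x] = 0]%classic.
Proof.
move=> np; apply: contrapT => /(@infinite_set_fset _ _ (size p)) [B sB leB].
have := max_poly_roots np (rs := enum_fset B) _ (fset_uniq B).
rewrite ltnNge leB => h.
suff /h : all (root p) (enum_fset B) by [].
by apply/allP => x xB; apply/rootP; apply: sB.
Qed.

Section Classes.
Variables (K : fieldType) (Kbar : closedFieldType) (iota : {rmorphism K -> Kbar}).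

Lemma wc4_map W : wc4 (map_weierstrass iota W) = iota (wc4 W).
Proof. by rewrite /wc4 /= !(rmorph_nat, rmorphXn, rmorphB, rmorphM, rmorphD). Qed.

Lemma wdisc_map W : wdisc (map_weierstrass iota W) = iota (wdisc W).
Proof.
by rewrite /wdisc /= !(rmorph_nat, rmorphXn, rmorphB, rmorphN, rmorphM, rmorphD).
Qed.

Lemma geom_iso_j (E E' : elliptic_curve K) : 2%:R != 0 :> K -> geom_iso iota E E' ->
  wc4 E ^+ 3 * wdisc E' = wc4 E' ^+ 3 * wdisc E.
Proof.
move=> n2 /weierstrass_iso_j h; apply: (fmorph_inj iota).
rewrite !(rmorphM, rmorphXn) /= -!wc4_map -!wdisc_map; apply: h.
by rewrite -(rmorph_nat iota) fmorph_eq0.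
Qed.

Lemma geom_iso_refl (E : elliptic_curve K) : geom_iso iota E E.
Proof.
exists 1, 0, 0, 0; split; first exact: oner_neq0.
by move=> x y; rewrite !expr1n !mul1r !mul0r !addr0.
Qed.
End Classes.

(** * From noncuspidal points to isomorphism classes *)

Section ModularFamily.
Variables (K : fieldType) (Kbar : closedFieldType) (iota : {rmorphism K -> Kbar}).
Hypotheses (n2 : 2%:R != 0 :> K) (n3 : 3%:R != 0 :> K).

Definition noncuspidal (X : K) : Prop :=
  exists Y, [/\ Y ^+ 2 = X ^+ 3 + 1, X != 0, X ^+ 3 != - 1 & X ^+ 3 != 8%:R].

(** The value of [t] for which [X] is a root of [Z^3 - 3 t Z^2 + 4]. *)
Definition hesse_parameter (X : K) := (X ^+ 3 + 4%:R) / (3%:R * X ^+ 2).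

Lemma hesse_parameter_neq1 X : noncuspidal X -> hesse_parameter X ^+ 3 != 1.
Proof.
move=> [Y [_ nX nX1 nX8]]; rewrite -subr_eq0.
have -> : hesse_parameter X ^+ 3 - 1
    = (X ^+ 3 + 1) * (X ^+ 3 - 8%:R) ^+ 2 / (3%:R * X ^+ 2) ^+ 3.
  by rewrite /hesse_parameter; field; nonzero.
by rewrite !mulf_neq0 ?invr_eq0 ?expf_neq0 ?mulf_neq0 ?subr_eq0 // addr_eq0.
Qed.

Lemma noncuspidal_embeds (w X : K) (nX : noncuspidal X) : w ^+ 2 + w + 1 = 0 ->
  embeds_in_points ('Z_6 * 'Z_6)%type (hesse_curve n3 (hesse_parameter_neq1 nX)).
Proof.
move=> ew; case: (nX) => Y [eY X0 nX1 nX8].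
have nY : Y != 0 by apply: contraNneq nX1 => Y0; rewrite -addr_eq0 -eY Y0 expr0n.
have n4 : 4%:R != 0 :> K by rewrite (natrM _ 2 2) mulf_neq0.
have eX : X ^+ 3 = Y ^+ 2 - 1 by rewrite eY addrK.
(* For [s = 1] and [s = - 1] these are the two roots other than [X]: their sum is [4 / X^2] and
   their product [- 4 / X]. *)
have root s : s ^+ 2 = 1 -> let Z := 2%:R * (1 + s * Y) / X ^+ 2 in
   Z ^+ 3 - 3%:R * hesse_parameter X * Z ^+ 2 + 4%:R = 0.
  move=> es /=; transitivity (4%:R * ((X ^+ 3) ^+ 2 + 2%:R * (1 + s * Y) ^+ 3 -
      (X ^+ 3 + 4%:R) * (1 + s * Y) ^+ 2) / X ^+ 6).
    by rewrite /hesse_parameter; field; nonzero.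
  rewrite eX [X in 4%:R * X](_ : _ =
    (s ^+ 2 - 1) * (2%:R * s * Y ^+ 3 + Y ^+ 2 * (3%:R - Y ^+ 2))); last by ring.
  by rewrite es subrr mul0r mulr0 mul0r.
apply: (hesse_embeds n2 n3 _ ew (Z1 := 2%:R * (1 + 1 * Y) / X ^+ 2)
   (Z2 := 2%:R * (1 + (- 1) * Y) / X ^+ 2)).
- rewrite -subr_eq0 (_ : _ - _ = 4%:R * Y / X ^+ 2); last by field.
  by nonzero.
- by apply: root; rewrite expr1n.
- by apply: root; rewrite sqrrN expr1n.
Qed.

Local Open Scope classical_set_scope.

(** [27 (t^3 - 1)^3] and [9 t (t^3 + 8)] are the discriminant and [c4] of [E_t], so the condition
    prescribes the j-invariant [c / d]. It leaves finitely many [t], and each [t] comes from at most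
    three [X]. *)
Lemma finite_j_fibre (c d : K) : d != 0 -> finite_set [set X | noncuspidal X /\
  let t := hesse_parameter X in
  c * (27%:R * (t ^+ 3 - 1) ^+ 3) = (9%:R * t * (t ^+ 3 + 8%:R)) ^+ 3 * d].
Proof.
move=> nd.
pose p : {poly K} := (9%:R *: 'X * ('X^3 + 8%:R%:P)) ^+ 3 * d%:P
  - (27%:R * c)%:P * ('X^3 - 1%:P) ^+ 3.
have ep t : p.[t] = (9%:R * t * (t ^+ 3 + 8%:R)) ^+ 3 * d - c * (27%:R * (t ^+ 3 - 1) ^+ 3).
  by rewrite /p !(hornerXn, hornerX, hornerC, horner_exp, hornerN, hornerD, hornerZ, hornerM); ring.
have np : p != 0.
  (* At [t = 1] only the first term survives, with value [9^6 d]. *)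
  apply/negP => /eqP p0; have : 9%:R ^+ 6 * d = 0.
    by rewrite -(horner0 1) -p0 ep; ring.
  move/eqP; rewrite mulf_eq0 expf_eq0 (negbTE nd) orbF /=.
  by rewrite (natrM _ 3 3) mulf_eq0 (negbTE n3).
pose q t : {poly K} := 'X^3 - (3%:R * t) *: 'X^2 + 4%:R%:P.
have eq t X : (q t).[X] = X ^+ 3 - 3%:R * t * X ^+ 2 + 4%:R.
  by rewrite /q !(hornerXn, hornerX, hornerC, horner_exp, hornerN, hornerD, hornerZ, hornerM); ring.
have nq t : q t != 0.
  apply/negP => /eqP q0; have : 2%:R * 2%:R = 0 :> K.
    by rewrite -[RHS](horner0 0) -(q0 : q t = 0) eq; ring.
  by move/eqP; rewrite mulf_eq0 (negbTE n2).
apply: (@sub_finite_set _ _ (\bigcup_(t in [set t | p.[t] = 0]) [set X | (q t).[X] = 0])).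
  move=> X [[Y [_ nX _ _]] /= e]; exists (hesse_parameter X) => /=.
    by rewrite ep e subrr.
  by rewrite eq /hesse_parameter; field; nonzero.
apply: bigcup_finite; first exact: finite_poly_roots.
by move=> t _; apply: finite_poly_roots.
Qed.

(** A class determines the j-invariant and hence contains [E_t] for finitely many [X] only; finitely
    many classes would leave finitely many [X]. *)
Lemma infinite_geom_classes (w : K) : w ^+ 2 + w + 1 = 0 ->
  infinite_set [set X | noncuspidal X] ->
  infinite_set (geom_classes ('Z_6 * 'Z_6)%type iota).
Proof.
move=> ew infX finC; apply: infX.
pose cls X := match pselect (noncuspidal X) with
  | left nX => [set E' | geom_iso iota (hesse_curve n3 (hesse_parameter_neq1 nX)) E']
  | right _ => set0 end.
pose S := [set X | noncuspidal X].
have clsP X : S X -> geom_classes ('Z_6 * 'Z_6)%type iota (cls X).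
  rewrite /cls /S /=; case: pselect => // nX _.
  by exists (hesse_curve n3 (hesse_parameter_neq1 nX)) => //; apply: noncuspidal_embeds ew.
apply: (@sub_finite_set _ _ (\bigcup_(C in cls @` S) (S `&` [set X | cls X = C]))).
  by move=> X SX; exists (cls X) => //; exists X.
apply: bigcup_finite.
  by apply: sub_finite_set finC => _ [X SX <-]; apply: clsP.
move=> _ [X SX <-].
pose E := hesse_curve n3 (hesse_parameter_neq1 SX).
have nd : wdisc E != 0 by case: (E).
apply: sub_finite_set (finite_j_fibre (wc4 E ^+ 3) nd) => X' [SX' /= eC]; split=> //=.
have : cls X' (hesse_curve n3 (hesse_parameter_neq1 SX')).
  rewrite /cls; case: pselect => // nX'.
  by rewrite (Prop_irrelevance nX' SX') /=; apply: geom_iso_refl.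
rewrite eC /cls; case: pselect => // nX /=.
rewrite (Prop_irrelevance nX SX) -/E => /(geom_iso_j n2).
rewrite [wdisc (hesse_curve _ _)]wdisc_hesse => ->; congr (_ ^+ 3 * _).
by rewrite /wc4 /=; ring.
Qed.
End ModularFamily.

(** * Quadratic extensions *)

Lemma fieldext_rat_natS_neq0 (K : fieldExtType rat) n : (n.+1%:R : K) != 0.
Proof. by rewrite -(rmorph_nat (in_alg K)) fmorph_eq0 pnatr_eq0. Qed.

Lemma rat_sqr_neq3 (q : rat) : q ^+ 2 != 3%:R.
Proof.
apply/negP => /eqP e.
have e1 : (numq q) ^+ 2 = 3%:R * (denq q) ^+ 2.
  apply: (@intr_inj rat); rewrite !(rmorphM, rmorphXn, rmorph_nat) /= -e.
  by rewrite numqE; ring.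
have e2 : (`|numq q| ^ 2 = 3 * `|denq q| ^ 2)%N.
  by apply/eqP; rewrite -eqz_nat; apply/eqP; rewrite !(PoszM, abszX) -?exprnP; lia.
have n0 : (0 < `|denq q|)%N by rewrite absz_gt0 denq_neq0.
have m0 : (0 < `|numq q|)%N.
  by case: (posnP `|numq q|%N) => // m0; move: e2; rewrite m0; nia.
have := congr1 (logn 3) e2.
rewrite lognM ?expn_gt0 ?n0 // !lognX (_ : logn 3 3 = 1%N) //.
by lia.
Qed.

Section QuadraticSubfield.
Variable K : fieldExtType rat.

Lemma Fadjoin_sqrtP (s : K) (d : rat) x : s ^+ 2 = d%:A -> x \in <<1; s>>%VS ->
  exists a b : rat, x = a%:A + b%:A * s.
Proof.
move=> es /Fadjoin_poly_eq <-.
have := Fadjoin_polyOver 1%AS s x; move: (Fadjoin_poly _ _ _) => p /polyOverP hp.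
rewrite horner_coef; elim/big_ind: _ => [|_ _ [a [b ->]] [a' [b' ->]]|i _].
- by exists 0, 0; rewrite !scale0r mul0r addr0.
- by exists (a + a'), (b + b'); rewrite !scalerDl; ring.
- have /vlineP[c ->] := hp i; move: (nat_of_ord i) => n {i}.
  elim: n => [|n [a [b IH]]]; first by exists c, 0; rewrite scale0r mul0r addr0 expr0 mulr1.
  exists (b * d), a; rewrite exprSr mulrA IH mulrDl -mulrA -expr2 es.
  by rewrite -[(b * d)%:A]scalerA -[b%:A * _]scalerAl mul1r addrC.
Qed.

Lemma dim_Fadjoin_ge2 (s : K) : s \notin 1%VS -> (2 <= \dim <<1; s>>)%N.
Proof.
move=> ns; rewrite dim_Fadjoin dimv1 muln1.
have : adjoin_degree 1%AS s != 1%N by rewrite adjoin_deg_eq1.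
by rewrite /adjoin_degree; case: (_.-1).
Qed.

(** The dimensions give [[K : U] <= 2], so the minimal polynomial of [x] over [U] has degree at most
    2. *)
Lemma quadratic_relation (U : {subfield K}) x : \dim {: K} = 4%N -> (2 <= \dim U)%N ->
  exists b c, [/\ b \in U, c \in U & x ^+ 2 + b * x + c = 0].
Proof.
move=> d4 d2.
have le4 : (adjoin_degree U x * \dim U <= 4)%N by rewrite -dim_Fadjoin -d4 dimvS ?subvf.
have := minPolyOver U x; have := size_minPoly U x; have := monic_minPoly U x.
have := minPolyxx U x; move: (minPoly U x) => p px mp sp /polyOverP pU.
have [n1|n1] := eqVneq (adjoin_degree U x) 1%N.
  have xU : x \in U by rewrite -adjoin_deg_eq1 n1.
  by exists (- x), 0; rewrite memvN mem0v xU; split=> //; ring.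
have n2 : adjoin_degree U x = 2%N.
  have n0 : (0 < adjoin_degree U x)%N by [].
  move: le4 n0 n1; case: (adjoin_degree U x) => [|[|[|n]]] // le4 _ _.
  by have := leq_mul (leqnn n.+3) d2; lia.
exists p`_1, p`_0; split; rewrite ?pU //.
rewrite -[RHS]px horner_coef sp n2 !big_ord_recl big_ord0 /=.
move/monicP: mp; rewrite /lead_coef sp n2 /= => ->.
by rewrite expr0 expr1; ring.
Qed.

Lemma sqrt3_notin1 (s : K) : s ^+ 2 = 3%:R -> s \notin 1%VS.
Proof.
move=> es; apply/negP => /vlineP[k ek].
case/eqP: (rat_sqr_neq3 k); apply: (fmorph_inj (in_alg K)).
by rewrite rmorphXn rmorph_nat /= -ek.
Qed.

Lemma sqr_in_Q_sqrt3 (s x : K) (c d : rat) : s ^+ 2 = 3%:R -> x \in <<1; s>>%VS ->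
  x ^+ 2 = c%:A + d%:A * s ->
  exists a b : rat, a ^+ 2 + 3%:R * b ^+ 2 = c /\ 2%:R * a * b = d.
Proof.
move=> es xU; have es' : s ^+ 2 = (3%:R : rat)%:A by rewrite es scaler_nat.
have [a [b ->]] := Fadjoin_sqrtP es' xU => e; exists a, b.
have e' : (a ^+ 2 + 3%:R * b ^+ 2 - c)%:A = (d - 2%:R * a * b)%:A * s.
  apply/subr0_eq; rewrite -(subrr (c%:A + d%:A * s)) -{1}e.
  transitivity (in_alg K (a ^+ 2 + 3%:R * b ^+ 2 - c) - in_alg K (d - 2%:R * a * b) * s) => //.
  rewrite !(rmorph_nat, rmorphXn, rmorphB, rmorphM, rmorphD) /= -es; ring.
have [d0|nd0] := eqVneq (d - 2%:R * a * b) 0.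
  move: e'; rewrite d0 scale0r mul0r => /eqP; rewrite scaler_eq0 oner_eq0 orbF => /eqP h.
  by split; [apply/subr0_eq | apply/esym/subr0_eq].
case/negP: (sqrt3_notin1 es).
have -> : s = ((a ^+ 2 + 3%:R * b ^+ 2 - c) / (d - 2%:R * a * b))%:A.
  have nA : (d - 2%:R * a * b)%:A != 0 :> K by rewrite scaler_eq0 oner_eq0 orbF.
  apply: (mulfI nA); rewrite -e'.
  by rewrite -[RHS](rmorphM (in_alg K)) [_ * (_ / _)]mulrC divfK.
by apply/vlineP; eexists.
Qed.

(* With [s = sqrt 3], [K] would be [Q(s, i)], whereas neither [6 s - 9] nor its opposite
   is a square in the real field [Q(s)]. *)
Lemma not_sqr_6sqrt3_sub9 (s i z : K) : \dim {: K} = 4%N ->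
  s ^+ 2 = 3%:R -> i ^+ 2 = - 1 -> z ^+ 2 = 6%:R * s - 9%:R -> False.
Proof.
move=> d4 es ei ez; pose U := <<1%AS; s>>%AS.
have sU : s \in U by apply: memv_adjoin.
have iU : i \notin U.
  apply/negP => iU.
  have [|a [b [e _]]] := @sqr_in_Q_sqrt3 s i (- 1) 0 es iU.
    by rewrite scale0r mul0r addr0 ei scaleN1r.
  by have := sqr_ge0 a; have := sqr_ge0 b; move: e; lra.
(* As [z^2] lies in [U], the equation of [z + i] is linear in [z], with coefficient [b + 2 i].
   Multiplying by [b - 2 i] solves it as [z = p + q i] with [p], [q] in [U]. *)
have [b [c [bU cU e]]] := quadratic_relation (U := U) (z + i) d4
  (dim_Fadjoin_ge2 (sqrt3_notin1 es)).
have natU n : n%:R \in U by rewrite rpred_nat.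
pose f := z ^+ 2 - 1 + c.
have fU : f \in U.
  by rewrite /f ez rpredD // rpredB ?rpred1 // rpredB // rpredM.
have nb : b ^+ 2 + 4%:R != 0.
  apply/negP => /eqP b4.
  have n2 : 2%:R != 0 :> K := fieldext_rat_natS_neq0 K 1.
  have h : (b / 2%:R) ^+ 2 = - 1.
    apply/subr0_eq; transitivity ((b ^+ 2 + 4%:R) / 4%:R).
      by field; rewrite n2 (fieldext_rat_natS_neq0 K 3).
    by rewrite b4 mul0r.
  have : (i - b / 2%:R) * (i + b / 2%:R) = 0 by rewrite -subr_sqr ei h subrr.
  move/eqP; rewrite mulf_eq0 subr_eq0 addr_eq0 => /orP[] /eqP ib; case/negP: iU;
    by rewrite ib ?rpredN rpred_div.
pose p := - (2%:R + f) * b / (b ^+ 2 + 4%:R); pose q := (2%:R * f - b ^+ 2) / (b ^+ 2 + 4%:R).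
have ub : b ^+ 2 + 4%:R \in U by rewrite rpredD ?rpredX.
have pU : p \in U by rewrite rpred_div // rpredM // rpredN rpredD.
have qU : q \in U by rewrite rpred_div // rpredB ?rpredM ?rpredX.
have zpq : z = p + q * i.
  apply: (mulfI nb).
  have -> : (b ^+ 2 + 4%:R) * (p + q * i) = - (2%:R + f) * b + (2%:R * f - b ^+ 2) * i.
    by rewrite /p /q; field.
  apply/subr0_eq; transitivity ((b - 2%:R * i) * ((z + i) ^+ 2 + b * (z + i) + c)
     + (i ^+ 2 + 1) * (4%:R * z + b + 2%:R * i)); last by rewrite e ei; ring.
  by rewrite /f; ring.
have pq : p * q = 0.
  apply/eqP; apply: contraNT iU => npq.
  have n2 : 2%:R != 0 :> K := fieldext_rat_natS_neq0 K 1.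
  have -> : i = (z ^+ 2 - p ^+ 2 + q ^+ 2) / (2%:R * (p * q)).
    rewrite zpq; apply: (mulIf (mulf_neq0 n2 npq)); rewrite (divfK (mulf_neq0 n2 npq)).
    transitivity (2%:R * (p * q) * i + q ^+ 2 * (i ^+ 2 + 1)); last by ring.
    by rewrite ei; ring.
  have z2U : z ^+ 2 \in U by rewrite ez rpredB ?rpredM.
  apply: rpred_div; last by apply: rpredM => //; apply: rpredM.
  by apply: rpredD; [apply: rpredB => //|]; apply: rpredX.
have e6 : 6%:R * s - 9%:R = (- 9%:R)%:A + (6%:R)%:A * s :> K.
  by rewrite scaleNr !scaler_nat addrC.
move/eqP: pq; rewrite mulf_eq0 => /orP[] /eqP h.
- have [|a' [b' [e1 e2]]] := @sqr_in_Q_sqrt3 s q 9%:R (- 6%:R) es qU.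
    rewrite scaleNr !scaler_nat; apply/subr0_eq.
    transitivity (- (z ^+ 2 - (6%:R * s - 9%:R)) + q ^+ 2 * (i ^+ 2 + 1)).
      by rewrite zpq h; ring.
    by rewrite ez ei; ring.
  (* [9 - 6 s] has negative norm [81 - 108], whereas the norm of a square is the square of a
     rational. *)
  have := sqr_ge0 (a' ^+ 2 - 3%:R * b' ^+ 2).
  rewrite (_ : (a' ^+ 2 - 3%:R * b' ^+ 2) ^+ 2 =
    (a' ^+ 2 + 3%:R * b' ^+ 2) ^+ 2 - 3%:R * (2%:R * a' * b') ^+ 2); last by ring.
  by rewrite e1 e2; lra.
- have [|a' [b' [e1 e2]]] := @sqr_in_Q_sqrt3 s p (- 9%:R) 6%:R es pU.
    by rewrite -e6 -ez zpq h mul0r addr0.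
  by have := sqr_ge0 a'; have := sqr_ge0 b'; move: e1; lra.
Qed.

End QuadraticSubfield.

(** * A valuation above 2 *)

Section ValuationRing.
Local Open Scope classical_set_scope.
Variable K : fieldType.

Definition subring_without (h : K) (B : set K) :=
  [/\ B 1, forall x y, B x -> B y -> B (x - y),
      forall x y, B x -> B y -> B (x * y) & ~ B h].

Section Closure.
Variables (h : K) (B : set K).
Hypothesis sB : subring_without h B.

Lemma subring0 : B 0.
Proof. by case: sB => B1 BB _ _; rewrite -(subrr 1); apply: BB. Qed.

Lemma subringN x : B x -> B (- x).
Proof. by case: sB => _ BB _ _ Bx; rewrite -sub0r; apply: BB => //; apply: subring0. Qed.

Lemma subringD x y : B x -> B y -> B (x + y).
Proof. by case: sB => _ BB _ _ Bx By; rewrite -[y]opprK; apply/BB/subringN. Qed.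

Lemma subringM x y : B x -> B y -> B (x * y).
Proof. by case: sB => _ _ BM _; apply: BM. Qed.

Lemma subringX x n : B x -> B (x ^+ n).
Proof.
move=> Bx; elim: n => [|n IH]; first by case: sB.
by rewrite exprS; apply: subringM.
Qed.

Lemma subring_sum (I : Type) (r : seq I) (P : pred I) (F : I -> K) :
  (forall i, B (F i)) -> B (\sum_(i <- r | P i) F i).
Proof. by move=> hF; elim/big_ind: _ => //; [apply: subring0 | apply: subringD]. Qed.
End Closure.

Lemma maximal_subring_without (h : K) : (exists B, subring_without h B) ->
  exists B, subring_without h B /\
    forall C, subring_without h C -> B `<=` C -> C `<=` B.
Proof.
move=> [B0 sB0].
have [|A [PA maxA]] := @Zorn_bigcup K [set A | A = set0 \/ subring_without h A].
  move=> F FP totF /=.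
  have [[A FA sA]|noA] := pselect (exists2 A, F A & subring_without h A); last first.
    left; rewrite -subset0 => x [A FA Ax]; case: (FP _ FA) => [A0|sA].
      by rewrite A0 in Ax.
    by case: noA; exists A.
  right; have sub X x : F X -> X x -> subring_without h X.
    by move=> FX Xx; case: (FP _ FX) => // X0; rewrite X0 in Xx.
  have two x y : (\bigcup_(X in F) X) x -> (\bigcup_(X in F) X) y ->
      exists X, [/\ F X, subring_without h X, X x & X y].
    move=> [X FX Xx] [Y FY Yy]; case: (totF _ _ FX FY) => XY.
      by exists Y; split=> //; [apply: sub Yy | apply: XY].
    by exists X; split=> //; [apply: sub Xx | apply: XY].
  split.
  - by exists A => //; case: sA.
  - by move=> x y /two/[apply] -[X [FX [_ BB _ _] Xx Xy]]; exists X => //; apply: BB.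
  - by move=> x y /two/[apply] -[X [FX [_ _ BM _] Xx Xy]]; exists X => //; apply: BM.
  - by move=> [X FX Xh]; case: (sub _ _ FX Xh).
have sA : subring_without h A.
  case: PA => // A0; case: (maxA B0); last by right.
  rewrite A0; split; first exact: sub0set.
  by move=> /(_ 1); apply; case: sB0.
exists A; split=> // C sC AC; apply: contrapT => nCA.
by case: (maxA C); [split | right].
Qed.

Section Maximal.
Variable B : set K.
Hypotheses (n2 : 2%:R != 0 :> K) (sB : subring_without 2%:R^-1 B).
Hypothesis maxB : forall C, subring_without 2%:R^-1 C -> B `<=` C -> C `<=` B.

Let B1 : B 1. Proof. by case: sB. Qed.
Let Bh : ~ B 2%:R^-1. Proof. by case: sB. Qed.

(** [B[x]] is strictly larger than [B], so by maximality it contains [1/2]. *)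
Lemma half_in_adjoin x : ~ B x ->
  exists n (c : nat -> K), (forall k, B (c k)) /\
    2%:R * \sum_(k < n) c k * x ^+ k = 1.
Proof.
move=> nBx; pose C := [set z | exists p : {poly K}, (forall i, B p`_i) /\ p.[x] = z].
have BC : B `<=` C.
  move=> z Bz; exists z%:P; split; last by rewrite hornerC.
  by move=> i; rewrite coefC; case: ifP => // _; apply: subring0 sB.
have [Ch|nCh] := pselect (C 2%:R^-1).
  case: Ch => p [Bp ep]; exists (size p), (fun k => p`_k); split=> //.
  by rewrite -horner_coef ep mulfV.
case: nBx; apply: (maxB (C := C)) => //; last first.
  exists 'X; split; last by rewrite hornerX.
  by move=> i; rewrite coefX; case: eqP => // _; apply: subring0 sB.
split=> //; first exact: BC.
- move=> _ _ [p [Bp <-]] [q [Bq <-]]; exists (p - q); split; last by rewrite !hornerE.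
  by move=> i; rewrite coefB; case: sB => _ BB _ _; apply: BB.
- move=> _ _ [p [Bp <-]] [q [Bq <-]]; exists (p * q); split; last by rewrite hornerM.
  by move=> i; rewrite coefM; apply: (subring_sum sB) => j; apply: (subringM sB).
Qed.

(** With [u = 1 - 2 c], if [1/u] is not in [B] then [1/2] lies in [B[1/u]]. Multiplying that
    relation by [u^n], again of the form [1 - 2 c'], puts [1/2] in [B]. *)
Lemma odd_unit c : B c -> B (1 - 2%:R * c)^-1.
Proof.
move=> Bc; set u := 1 - _.
have Bu : B u.
  apply: (subringD sB) => //; apply: (subringN sB); apply: (subringM sB) => //.
  by rewrite mulr2n; apply: (subringD sB).
have nu : u != 0.
  rewrite subr_eq0; apply/negP => /eqP e; apply: Bh.
  by rewrite (_ : 2%:R^-1 = c) //; apply: (mulfI n2); rewrite mulfV // -e.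
apply: contrapT => /half_in_adjoin[n [d [Bd ed]]]; apply: Bh.
have [c' Bc' ec'] : exists2 c', B c' & u ^+ n = 1 - 2%:R * c'.
  elim: (n) => [|m [c' Bc' IH]].
    by exists 0; [apply: subring0 sB | rewrite mulr0 subr0].
  exists (c' + c - 2%:R * c' * c); last by rewrite exprS IH /u; ring.
  rewrite (_ : _ - _ = c' * u + c); last by rewrite /u; ring.
  by apply: (subringD sB) => //; apply: (subringM sB).
have -> : 2%:R^-1 = c' + \sum_(k < n) d k * u ^+ (n - k).
  apply: (mulfI n2); rewrite mulfV // mulrDr.
  have -> : 2%:R * \sum_(k < n) d k * u ^+ (n - k) = u ^+ n.
    transitivity (u ^+ n * (2%:R * \sum_(k < n) d k * u^-1 ^+ k)).
      2: by rewrite ed mulr1.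
    rewrite mulrCA; congr (_ * _); rewrite mulr_sumr; apply: eq_bigr => k _.
    by rewrite mulrCA exprVn -expfB_cond // (negbTE nu) (ltnW (ltn_ord k)).
  by rewrite ec'; ring.
apply: (subringD sB) => //; apply: (subring_sum sB) => k.
by apply: (subringM sB) => //; apply: (subringX sB).
Qed.

(* Chevalley's descent: with [x] and [1/x] both outside [B], a relation of least
   degree exhibiting [1/2] in [B[x]] can be shortened by means of one in [B[1/x]]. *)
Lemma maximal_valuation x : B x \/ B x^-1.
Proof.
pose D y n := exists c : nat -> K, (forall k, B (c k)) /\
  2%:R * \sum_(k < n) c k * y ^+ k = 1.
have DW y n m : (n <= m)%N -> D y n -> D y m.
  move=> nm [c [Bc ec]]; exists (fun k => if (k < n)%N then c k else 0); split.
    by move=> k; case: ifP => // _; apply: subring0 sB.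
  rewrite -[RHS]ec (big_ord_widen m (fun k => c k * y ^+ k) nm) [in RHS]big_mkcond /=.
  by congr (_ * _); apply: eq_bigr => k _; case: ifP => //; rewrite mul0r.
have n1 y n : ~ B y -> D y n -> (1 < n)%N.
  move=> nBy; case: n => [|[|//]] [c [Bc]].
    by rewrite big_ord0 mulr0 => /esym/eqP; rewrite oner_eq0.
  rewrite big_ord1 expr0 mulr1 => e; case: Bh.
  by rewrite (_ : 2%:R^-1 = c 0%N) //; apply: (mulfI n2); rewrite mulfV // e.
suff shorten y n m : (m <= n.+1)%N -> ~ B y -> ~ B y^-1 -> D y n.+1 -> D y^-1 m -> D y n.
  apply: contrapT => /not_orP[nBx nBx'].
  have [n Dn] := half_in_adjoin nBx; have [m Dm] := half_in_adjoin nBx'.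
  suff descent N y a b : (a + b <= N)%N -> ~ B y -> ~ B y^-1 -> D y a -> D y^-1 b -> False.
    exact: (descent (n + m)%N x n m).
  elim: N y a b => [|N IH] y a b ab nBy nBy' Da Db.
    by have := n1 _ _ nBy Da; lia.
  have a1 := n1 _ _ nBy Da; have b1 := n1 _ _ nBy' Db.
  have [ba|ba] := leqP b a.
    case: a ab Da ba a1 => // a ab Da ba _.
    apply: (IH y a b) => //.
    exact: shorten Da Db.
  case: b ab Db ba b1 => // b ab Db ba _.
  apply: (IH y a b) => //; first by rewrite addnS in ab.
  by apply: (shorten y^-1 b a) => //; rewrite ?invrK //; apply: ltnW.
move=> mn nBy nBy' [c [Bc ec]] /(DW _ _ _ mn) [d [Bd ed]].
have y0 : y != 0 by apply/eqP => y0; apply: nBy; rewrite y0; apply: subring0 sB.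
pose u := 1 - 2%:R * d 0%N.
have Bu : B u^-1 by apply: odd_unit.
have nu : u != 0.
  rewrite subr_eq0; apply/negP => /eqP e; apply: Bh.
  by rewrite (_ : 2%:R^-1 = d 0%N) //; apply: (mulfI n2); rewrite mulfV // -e.
(* The relation in [1/y], multiplied by [y^n / u], expresses [y^n] by lower powers with coefficients
   in [B], as [u] is a unit by [odd_unit]. Substituting in the relation in [y] removes its top
   term. *)
have eyn : y ^+ n = \sum_(k < n) 2%:R * u^-1 * d (n - k)%N * y ^+ k.
  apply: (mulfI nu).
  have eu : u = 2%:R * \sum_(k < n) d k.+1 * y^-1 ^+ k.+1.
    rewrite /u; transitivity (2%:R * \sum_(k < n.+1) d k * y^-1 ^+ k - 2%:R * d 0%N).
      by rewrite ed.
    rewrite big_ord_recl /= expr0 mulr1 mulrDr addrAC subrr add0r.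
    by congr (_ * _); apply: eq_bigr.
  have -> : \sum_(k < n) 2%:R * u^-1 * d (n - k)%N * y ^+ k =
      u^-1 * (2%:R * \sum_(k < n) d (n - k)%N * y ^+ k).
    by rewrite !mulr_sumr; apply: eq_bigr => k _; rewrite !mulrA [u^-1 * _]mulrC.
  rewrite mulVKf // {1}eu -mulrA; congr (_ * _); rewrite mulrC mulr_sumr.
  rewrite (reindex_inj rev_ord_inj) /=; apply: eq_bigr => k _.
  rewrite subnS prednK ?subn_gt0 ?ltn_ord // mulrCA; congr (_ * _).
  by rewrite exprVn -expfB_cond ?(negbTE y0) ?leq_subr // subKn // ltnW.
exists (fun k => c k + 2%:R * c n * u^-1 * d (n - k)%N); split.
  move=> k; apply: (subringD sB) => //; do !apply: (subringM sB) => //.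
  by rewrite mulr2n; apply: (subringD sB).
rewrite -[RHS]ec big_ord_recr /= eyn; congr (_ * _).
rewrite mulr_sumr -big_split /=; apply: eq_bigr => k _.
by move: u^-1 => v; ring.
Qed.
End Maximal.
End ValuationRing.

(** * The valuation above 2 of a quartic field containing [sqrt(-3)] *)

Section ValuationAbove2.
Local Open Scope classical_set_scope.
Variables (K : fieldExtType rat) (r : K).
Hypotheses (d4 : \dim {: K} = 4%N) (er : r ^+ 2 = - 3%:R).

Let n2 : 2%:R != 0 :> K := fieldext_rat_natS_neq0 K 1.

Section Ring.
Variable B : set K.
Hypotheses (sB : subring_without 2%:R^-1 B).
Hypothesis maxB : forall C, subring_without 2%:R^-1 C -> B `<=` C -> C `<=` B.

Let B1 : B 1. Proof. by case: sB. Qed.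
Let Bh : ~ B 2%:R^-1. Proof. by case: sB. Qed.
Let BV := maximal_valuation n2 sB maxB.
Let BM := subringM sB.
Let BD := subringD sB.
Let BX := subringX sB.

Definition vunit (u : K) := [/\ u != 0, B u & B u^-1].

Lemma vunitM u v : vunit u -> vunit v -> vunit (u * v).
Proof. by move=> [nu Bu Bu'] [nv Bv Bv']; split; rewrite ?mulf_neq0 ?invfM //; apply: BM. Qed.

Lemma vunitV u : vunit u -> vunit u^-1.
Proof. by move=> [nu Bu Bu']; split; rewrite ?invr_eq0 ?invrK. Qed.

Lemma vunitN u : vunit u -> vunit (- u).
Proof. by move=> [nu Bu Bu']; split; rewrite ?oppr_eq0 ?invrN //; apply: (subringN sB). Qed.

Lemma vunit1 : vunit 1. Proof. by split; rewrite ?oner_eq0 ?invr1. Qed.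

Lemma vring_nat n : B n%:R.
Proof. by elim: n => [|n IH]; [apply: subring0 sB | rewrite -natr1; apply: BD]. Qed.

Lemma vring_int n : B n%:~R.
Proof.
by case: n => n; rewrite ?NegzE ?rmorphN /=; [|apply: (subringN sB)]; apply: vring_nat.
Qed.

(** A valuation ring is local: either [m / (1 + m)] lies in [B], and with it [1 / (1 + m)], or its
    inverse [1 + 1/m] does, which would make [m] a unit. *)
Lemma vunit1D m : B m -> ~ vunit m -> vunit (1 + m).
Proof.
move=> Bm num.
have [m0|nm] := eqVneq m 0; first by rewrite m0 addr0; apply: vunit1.
have Bm' : ~ B m^-1 by move=> Bm'; apply: num.
have n1m : 1 + m != 0.
  rewrite addrC addr_eq0; apply/negP => /eqP e; apply: Bm'; rewrite e invrN invr1.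
  exact: (subringN sB B1).
split=> //; first exact: BD.
have [//|Bi] := BV (1 + m)^-1; rewrite invrK in Bi.
have [Bq|Bq] := BV (m / (1 + m)).
  rewrite (_ : (1 + m)^-1 = 1 - m / (1 + m)); last by field.
  by apply: BD => //; apply: (subringN sB Bq).
case: Bm'; rewrite (_ : m^-1 = (m / (1 + m))^-1 - 1); last by field; rewrite nm n1m.
by apply: BD => //; apply: (subringN sB B1).
Qed.

Lemma vunit_odd n : vunit (1 + 2%:R * n%:~R).
Proof.
have e : 1 + 2%:R * n%:~R = 1 - 2%:R * (- n)%:~R :> K by rewrite rmorphN; ring.
have Bu : B (1 + 2%:R * n%:~R).
  by apply: BD => //; apply: BM; [apply: vring_nat | apply: vring_int].
have Bu' : B (1 + 2%:R * n%:~R)^-1.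
  by rewrite e; apply: odd_unit => //; apply: vring_int.
split=> //; rewrite e subr_eq0; apply/negP => /eqP h; apply: Bh.
rewrite (_ : 2%:R^-1 = (- n)%:~R); first exact: vring_int.
by apply: (mulfI n2); rewrite mulfV // -h.
Qed.

Lemma vring_pow2 (n : int) u : vunit u -> B (2%:R ^ n * u) -> 0 <= n.
Proof.
move=> [nu _ Bu'] h; rewrite leNgt; apply/negP; case: n h => // n h _; apply: Bh.
rewrite (_ : 2%:R^-1 = 2%:R ^+ n * (2%:R ^ (Negz n) * u * u^-1)).
  by apply: BM; [apply/BX/vring_nat | apply: BM].
by rewrite mulfK // NegzE -exprnN exprS invfM mulrCA mulfV ?mulr1 // expf_neq0.
Qed.

Let w := (r - 1) / 2%:R.
Let ew : w ^+ 2 + w + 1 = 0.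
Proof.
transitivity ((r ^+ 2 + 3%:R) / 4%:R).
  by rewrite /w; field; rewrite n2 (fieldext_rat_natS_neq0 K 3).
by rewrite er addNr mul0r.
Qed.

Let Bw : B w.
Proof.
have w3 : w ^+ 3 = 1.
  by apply/subr0_eq; transitivity ((w - 1) * (w ^+ 2 + w + 1)); [ring | rewrite ew mulr0].
have w0 : w != 0 by apply/eqP => w0; move/eqP: w3; rewrite w0 expr0n eq_sym oner_eq0.
have [//|Bi] := BV w; rewrite (_ : w = w^-1 ^+ 2); first exact: BX.
by apply: (mulfI (expf_neq0 2 w0)); rewrite -exprSr w3 exprVn mulfV // expf_neq0.
Qed.

(* 2 is inert in [Q(r)]: the norm [p^2 - p q + q^2] is odd unless p and q are even. *)
Lemma eisenstein_pow2_unit (p q : int) : (p != 0) || (q != 0) ->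
  exists (k : nat) u, vunit u /\ p%:~R + q%:~R * w = 2%:R ^+ k * u.
Proof.
move: {2}(`|p| + `|q|)%N (leqnn (`|p| + `|q|)%N) => N.
elim: N p q => [|N IH] p q; first by lia.
move=> pN pq0.
have [e|o] := boolP ((2 %| p)%Z && (2 %| q)%Z).
  case/andP: e => /dvdzP[p' ep] /dvdzP[q' eq].
  have [||k [u [vu e]]] := IH p' q'; [by lia | by lia |].
  exists k.+1, u; split=> //; rewrite exprS -mulrA -e ep eq !rmorphM /=; ring.
have [n eN] : exists n, p ^+ 2 - p * q + q ^+ 2 = 1 + 2 * n.
  have half (x : int) : exists a, x = 2 * a \/ x = 2 * a + 1.
    by exists (x %/ 2)%Z; lia.
  have [a ep] := half p; have [b eq] := half q.
  case: ep => ep; case: eq => eq.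
  - by case/negP: o; rewrite ep eq !dvdz_mulr.
  - by exists (2 * a ^+ 2 - a * (2 * b + 1) + 2 * b ^+ 2 + 2 * b); rewrite ep eq; ring.
  - by exists (2 * a ^+ 2 + 2 * a - (2 * a + 1) * b + 2 * b ^+ 2); rewrite ep eq; ring.
  - exists (2 * a ^+ 2 + a - 2 * a * b + 2 * b ^+ 2 + b); rewrite ep eq; ring.
exists 0%N, (p%:~R + q%:~R * w); split; last by rewrite expr0 mul1r.
(* The conjugate [p + q w^2]; the product with it is the odd norm. *)
pose c := (p%:~R - q%:~R) - q%:~R * w.
have ec : (p%:~R + q%:~R * w) * c = 1 + 2%:R * n%:~R.
  transitivity ((p ^+ 2 - p * q + q ^+ 2)%:~R - q%:~R ^+ 2 * (w ^+ 2 + w + 1) : K).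
    by rewrite /c !(rmorphD, rmorphB, rmorphM, rmorphXn) /=; ring.
  by rewrite ew eN mulr0 subr0 rmorphD rmorphM.
have [nN BN BN'] := vunit_odd n.
have Bc : B c.
  apply: BD; last by apply: (subringN sB); apply: BM => //; apply: vring_int.
  by apply: BD; [|apply: (subringN sB)]; apply: vring_int.
split.
- by apply: contraNneq nN => e; rewrite -ec e mul0r.
- by apply: BD; [|apply: BM => //]; apply: vring_int.
- rewrite (_ : _^-1 = c / (1 + 2%:R * n%:~R)); first exact: BM.
  have nz : p%:~R + q%:~R * w != 0 by apply: contraNneq nN => e; rewrite -ec e mul0r.
  by apply: (mulfI nz); rewrite mulfV // mulrA ec mulfV.
Qed.

Lemma subfield_pow2_unit x : x \in <<1; r>>%VS -> x != 0 ->
  exists (k : int) u, vunit u /\ x = 2%:R ^ k * u.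
Proof.
move=> xU nx; have er' : r ^+ 2 = (- 3%:R : rat)%:A by rewrite er scaleNr scaler_nat.
have [a [b ex]] := Fadjoin_sqrtP er' xU.
pose d := denq a * denq b.
have nd : d != 0 by rewrite mulf_neq0 ?denq_neq0.
have intK (n : int) : (n%:~R : rat)%:A = n%:~R :> K by rewrite -(rmorph_int (in_alg K)).
have ea : a%:A * (denq a)%:~R = (numq a)%:~R :> K.
  by rewrite -!intK -[LHS](rmorphM (in_alg K)) numqE.
have eb : b%:A * (denq b)%:~R = (numq b)%:~R :> K.
  by rewrite -!intK -[LHS](rmorphM (in_alg K)) numqE.
have rw : r = 1 + 2%:R * w by rewrite /w; field.
pose P := numq a * denq b + numq b * denq a; pose Q := 2 * (numq b * denq a).
have exd : x * d%:~R = P%:~R + Q%:~R * w.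
  rewrite ex /P /Q /d !(rmorphD, rmorphM) /= -ea -eb rw; ring.
have nd' : d%:~R != 0 :> K by rewrite -intK scaler_eq0 oner_eq0 orbF intr_eq0.
have nPQ : (P != 0) || (Q != 0).
  apply: contraT; rewrite negb_or !negbK => /andP[/eqP P0 /eqP Q0].
  by move/eqP: exd; rewrite P0 Q0 mul0r addr0 mulf_eq0 (negbTE nx) (negbTE nd').
have nd0 : (d != 0) || (0 != 0 :> int) by rewrite nd.
have [k1 [u1 [vu1 e1]]] := eisenstein_pow2_unit nPQ.
have [k2 [u2 [vu2 e2]]] := eisenstein_pow2_unit nd0.
exists (k1%:Z - k2%:Z), (u1 / u2); split; first by apply/vunitM/vunitV.
apply: (mulIf nd'); rewrite exd e1; rewrite mul0r addr0 in e2; rewrite e2.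
have nu2 : u2 != 0 by case: vu2.
rewrite expfzDr // -exprnN -exprnP; have := expf_neq0 k2 n2.
by move: (2%:R ^+ k1) (2%:R ^+ k2) => A C nC; field; rewrite nC nu2.
Qed.

(** The value is read on [x^2] so that it stays an integer when 2 ramifies in [K]; this is the
    normalisation [v(2) = 2]. *)
Definition vrel x (n : int) := exists2 u, vunit u & x ^+ 2 = 2%:R ^ n * u.

(** A Newton polygon argument on [x^2 + b x + c = 0] over [Q(r)], where values are known. According
    to [z = b x / c]: [x^2] is [- c] times a unit if [z] is a nonunit of [B], [x = z c / b] settles
    the case of a unit, and otherwise [x] is [- b] times a unit. *)
Lemma vrel_exists x : x != 0 -> exists n, vrel x n.
Proof.
move=> nx.
have npow (k : int) : 2%:R ^ k != 0 :> K by rewrite expfz_neq0.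
have rN : r \notin 1%VS.
  apply/negP => /vlineP[k ek].
  have : k ^+ 2 = - 3%:R.
    by apply: (fmorph_inj (in_alg K)); rewrite rmorphXn rmorphN rmorph_nat /= -ek.
  by have := sqr_ge0 k; lra.
have [b [c [bU cU e]]] := quadratic_relation (U := <<1%AS; r>>%AS) x d4 (dim_Fadjoin_ge2 rN).
have sqr z k u : vunit u -> z = 2%:R ^ k * u -> vrel z (k + k).
  move=> vu ->; exists (u ^+ 2); first by rewrite expr2; apply: vunitM.
  by rewrite expfzDr // exprMn !expr2.
have [c0|nc] := eqVneq c 0.
  have ex : x = - b.
    apply: (mulfI nx); apply/subr0_eq; rewrite -e c0; ring.
  have xU : x \in <<1; r>>%VS by rewrite ex memvN.
  have [k [u [vu eu]]] := subfield_pow2_unit xU nx.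
  by exists (k + k); apply: sqr vu eu.
have [kc [uc [vc ec]]] := subfield_pow2_unit cU nc.
have ex2 : x ^+ 2 = - c * (1 + b * x / c).
  by apply/subr0_eq; rewrite -e; field.
have even z : vunit z -> x ^+ 2 = - c * z -> vrel x kc.
  move=> vz h; exists (- (uc * z)); first by apply/vunitN/vunitM.
  by rewrite h ec; ring.
have [b0|nb] := eqVneq b 0.
  by exists kc; apply: (even 1 vunit1); rewrite ex2 b0 !mul0r addr0.
have [kb [ub [vb eb]]] := subfield_pow2_unit bU nb.
have nubn : ub != 0 by case: vb.
have nucn : uc != 0 by case: vc.
set z := b * x / c in ex2.
have nz : z != 0 by rewrite !mulf_neq0 ?invr_eq0.
have [vz|nvz] := pselect (vunit z).
  exists ((kc - kb) + (kc - kb)); apply: (sqr _ _ (z * (uc / ub))).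
    by apply: vunitM => //; apply: vunitM => //; apply: vunitV.
  rewrite expfzDr // -invr_expz.
  transitivity (z * c / b); first by rewrite /z; field; rewrite nc nb.
  by rewrite ec eb invfM; ring.
have [Bz|Bz'] := BV z.
  by exists kc; apply: (even (1 + z)) => //; apply: vunit1D.
have vz1 : vunit (1 + z^-1).
  by apply: vunit1D => // /vunitV; rewrite invrK.
exists (kb + kb); apply: (sqr _ _ (- (ub * (1 + z^-1)))).
  by apply/vunitN/vunitM.
have -> : 2%:R ^ kb * - (ub * (1 + z^-1)) = - b * (1 + z^-1) by rewrite eb; ring.
apply: (mulfI nx); rewrite -expr2 ex2 /z; field.
by rewrite nc nx nb.
Qed.

Lemma vrel_uniq x n m : vrel x n -> vrel x m -> n = m.
Proof.
suff le n' m' : vrel x n' -> vrel x m' -> (n' <= m').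
  by move=> h1 h2; apply/eqP; rewrite eq_le !le.
move=> [u vu eu] [v vv ev]; rewrite -subr_ge0.
apply: (vring_pow2 (u := v / u)); first by apply/vunitM/vunitV.
have nu : u != 0 by case: vu.
have -> : 2%:R ^ (m' - n') * (v / u) = (2%:R ^ m' * v) / (2%:R ^ n' * u).
  by rewrite expfzDr // -invr_expz invfM mulrACA.
by rewrite -ev eu mulfV // mulf_neq0 // expfz_neq0.
Qed.

Lemma vrelM x y n m : vrel x n -> vrel y m -> vrel (x * y) (n + m).
Proof.
move=> [u vu eu] [v vv ev]; exists (u * v); first exact: vunitM.
by rewrite exprMn eu ev expfzDr // mulrACA.
Qed.

Lemma vrel2 : vrel 2%:R 2.
Proof. by exists 1; [apply: vunit1 | rewrite mulr1]. Qed.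

Lemma vring_vrel x n : vrel x n -> 0 <= n -> B x.
Proof.
move=> [u [_ Bu _] eu]; case: n eu => // n eu _.
have Bx2 : B (x ^+ 2) by rewrite eu; apply: BM => //; apply/BX/vring_nat.
have [//|Bi] := BV x; have [->|nx] := eqVneq x 0; first exact: subring0 sB.
by rewrite (_ : x = x ^+ 2 * x^-1); [apply: BM | rewrite expr2 mulfK].
Qed.

Lemma vrelD x y n m k : x != 0 -> y != 0 -> x + y != 0 ->
  vrel x n -> vrel y m -> vrel (x + y) k -> n <= m -> n <= k.
Proof.
move=> nx ny nxy vx vy vxy nm.
have nz : y / x != 0 by rewrite mulf_neq0 ?invr_eq0.
have [j vz] := vrel_exists nz.
have nz1 : 1 + y / x != 0.
  by rewrite (_ : 1 + y / x = (x + y) / x); [rewrite mulf_neq0 ?invr_eq0 | field].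
have [l vz1] := vrel_exists nz1.
have j0 : 0 <= j.
  have := vrelM vx vz; rewrite mulrCA divff // mulr1 => h.
  have := vrel_uniq h vy; lia.
have l0 : 0 <= l.
  have [u vu eu] := vz1; apply: (vring_pow2 vu); rewrite -eu; apply: BX.
  by apply: BD => //; apply: vring_vrel vz j0.
have := vrelM vx vz1; rewrite mulrDr mulr1 mulrCA divff // mulr1 => h.
by have := vrel_uniq h vxy; lia.
Qed.
End Ring.

Theorem valuation_above_2 : exists v : K -> int, [/\ v 2%:R = 2,
  forall x y, x != 0 -> y != 0 -> v (x * y) = v x + v y &
  forall x y, x != 0 -> y != 0 -> x + y != 0 -> v x <= v y -> v x <= v (x + y)].
Proof.
have [|B [sB maxB]] := @maximal_subring_without K 2%:R^-1.
  exists [set x | exists n : int, x = n%:~R]; split.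
  - by exists 1.
  - by move=> _ _ [n ->] [m ->]; exists (n - m); rewrite rmorphB.
  - by move=> _ _ [n ->] [m ->]; exists (n * m); rewrite rmorphM.
  - move=> [n en].
    have /intr_inj h : (2 * n)%:~R = 1%:~R :> rat.
      apply: (fmorph_inj (in_alg K)).
      by rewrite [LHS]rmorph_int [RHS]rmorph_int intrM -en mulfV.
    by move: h; lia.
(* The default [0] is taken only at [x = 0]. *)
pose v x : int := if pselect (exists n, vrel B x n) is left h then projT1 (cid h) else 0.
have vP x : x != 0 -> vrel B x (v x).
  move=> nx; rewrite /v; case: pselect => [h|]; first by case: cid.
  by case; apply: vrel_exists.
exists v; split.
- by apply: (vrel_uniq sB (vP _ n2)); apply: vrel2.
- move=> x y nx ny; apply: (vrel_uniq sB (vP _ (mulf_neq0 nx ny))).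
  by apply: vrelM => //; apply: vP.
- move=> x y nx ny nxy; apply: (vrelD sB maxB nx ny nxy); exact: vP.
Qed.

End ValuationAbove2.

(** * The orbit under duplication *)

Section Orbit.
Local Open Scope classical_set_scope.
Variables (K : fieldExtType rat) (r : K).
Hypotheses (d4 : \dim {: K} = 4%N) (er : r ^+ 2 = - 3%:R).

Let natK n : n.+1%:R != 0 :> K := fieldext_rat_natS_neq0 K n.

(* Abscissa of [2 P] for [P = (X, Y)] on [Y^2 = X^3 + 1]. *)
Definition dbl (X : K) := X * (X ^+ 3 - 8%:R) / (4%:R * (X ^+ 3 + 1)).

Let no_s (s z : K) : s ^+ 2 = 3%:R -> z ^+ 2 = 6%:R * s - 9%:R -> False.
Proof.
move=> es; apply: (not_sqr_6sqrt3_sub9 (i := r * s / 3%:R) d4 es).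
by rewrite expr_div_n exprMn er es; field; rewrite ?natK.
Qed.

Lemma noncuspidal_dbl X : noncuspidal X -> noncuspidal (dbl X).
Proof.
move=> [Y [eY nX nX1 nX8]].
have nY : Y != 0 by apply: contraNneq nX1 => Y0; rewrite -addr_eq0 -eY Y0 expr0n.
have eq : X ^+ 3 = Y ^+ 2 - 1 by rewrite eY addrK.
have n4 := natK 3; have n8 := natK 7; have n3 := natK 2.
have nX8' : X ^+ 3 - 8%:R != 0 by rewrite subr_eq0.
have nX1' : X ^+ 3 + 1 != 0 by rewrite addr_eq0.
pose q := X ^+ 3.
(* The ordinate of [2P], up to sign, by the duplication formula. *)
pose Y' := (q ^+ 2 + 20%:R * q - 8%:R) / (8%:R * Y ^+ 3).
have ed3 : dbl X ^+ 3 = q * (q - 8%:R) ^+ 3 / (64%:R * (q + 1) ^+ 3).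
  by rewrite /dbl /q; field; rewrite nX1' ?natK.
have eY' : Y' ^+ 2 = dbl X ^+ 3 + 1.
  rewrite ed3 /Y' /q eq; field.
  by rewrite nY ?natK addrNK expf_neq0.
exists Y'; split=> //.
- by rewrite /dbl !mulf_neq0 ?invr_eq0 ?mulf_neq0.
- apply/negP => /eqP e; move/eqP: eY'; rewrite e addNr sqrf_eq0 mulf_eq0 invr_eq0.
  rewrite [8%:R * _ == 0]mulf_eq0 (negbTE n8) expf_eq0 (negbTE nY) !orbF => /eqP e0.
  (* A vanishing ordinate means [q = - 10 + 6 s] with [s^2 = 3], whence [Y^2 = q + 1 = 6 s - 9]. *)
  apply: (no_s (s := (q + 10%:R) / 6%:R) (z := Y)).
    transitivity (3%:R + (q ^+ 2 + 20%:R * q - 8%:R) / 36%:R); last by rewrite e0 mul0r addr0.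
    by field; rewrite ?natK.
  by rewrite /q eq; field; rewrite ?natK.
(* The quartic equation in [q] given by [dbl X ^+ 3 = 8] splits over [Q(sqrt 3)] into
   quadratic factors, whose discriminants are 9 + 6 sqrt 3 up to squares. *)
- apply/negP => /eqP e.
  have e0 : (q ^+ 2 - 268%:R * q - 80%:R) ^+ 2 = 3%:R * (12%:R * (13%:R * q + 4%:R)) ^+ 2.
    apply/subr0_eq; transitivity (q * (q - 8%:R) ^+ 3 - 8%:R * (64%:R * (q + 1) ^+ 3)).
      by ring.
    have nD : 64%:R * (q + 1) ^+ 3 != 0 by rewrite mulf_neq0 ?natK ?expf_neq0.
    by rewrite -(divfK nD (q * (q - 8%:R) ^+ 3)) -ed3 e subrr.
  have n13 : 13%:R * q + 4%:R != 0.
    (* The resultant of [q^2 - 268 q - 80] and [13 q + 4] is 432. *)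
    apply: contraNneq (natK 431) => e13.
    move/eqP: e0; rewrite e13 !mulr0 expr0n mulr0 sqrf_eq0 => /eqP e0.
    apply/eqP; transitivity (169%:R * (q ^+ 2 - 268%:R * q - 80%:R)
      - (13%:R * q + 4%:R) * (13%:R * q - 3488%:R)); first by ring.
    by rewrite e0 e13 mulr0 mul0r subrr.
  pose s := (q ^+ 2 - 268%:R * q - 80%:R) / (12%:R * (13%:R * q + 4%:R)).
  have es : s ^+ 2 = 3%:R.
    rewrite /s expr_div_n e0 mulfK // expf_neq0 // mulf_neq0 //; exact: natK 11.
  have n30 : 30%:R + 18%:R * s != 0.
    apply: contraNneq (natK 71) => e30.
    by rewrite -oppr_eq0 -(mulr0 (30%:R - 18%:R * s)) -e30 -subr_eq0; apply/eqP;
      transitivity (324%:R * (s ^+ 2 - 3%:R)); [ring | rewrite es subrr mulr0].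
  pose z := (2%:R * q - 268%:R - 156%:R * s) / (2%:R * (30%:R + 18%:R * s)).
  have eqs : q ^+ 2 - 268%:R * q - 80%:R = s * (12%:R * (13%:R * q + 4%:R)).
    by rewrite /s divfK // mulf_neq0 // (natK 11).
  have ez : z ^+ 2 = 9%:R + 6%:R * s.
    have n60 : 2%:R * (30%:R + 18%:R * s) != 0 by rewrite mulf_neq0 ?natK.
    apply: (mulIf (expf_neq0 2 n60)); rewrite -exprMn /z divfK //; apply/subr0_eq.
    transitivity (4%:R * ((q ^+ 2 - 268%:R * q - 80%:R) - s * (12%:R * (13%:R * q + 4%:R)))
      - (13248%:R + 7776%:R * s) * (s ^+ 2 - 3%:R)); first by ring.
    by rewrite eqs es !subrr !mulr0 subrr.
  (* [r s / 3] is a square root of [- 1], so this product has square [- (9 + 6 s) = 6 (- s) - 9]. *)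
  apply: (no_s (s := - s) (z := r * s / 3%:R * z)); first by rewrite sqrrN.
  by rewrite exprMn ez expr_div_n exprMn er es; field; rewrite ?natK.
Qed.

Lemma infinite_orbit (T : Type) (A : set T) (f : T -> T) (h : T -> nat) x :
  A x -> (forall y, A y -> A (f y) /\ (h y < h (f y))%N) -> infinite_set A.
Proof.
move=> Ax hf finA.
have Ai n : A (iter n f x) by elim: n => //= n IH; case: (hf _ IH).
have inj : injective (fun n => iter n f x).
  have mono n m : (n < m)%N -> (h (iter n f x) < h (iter m f x))%N.
    elim: m => // m IH; rewrite ltnS leq_eqVlt => /orP[/eqP ->|/IH lt] /=.
      by case: (hf _ (Ai m)).
    by apply: ltn_trans lt _; case: (hf _ (Ai m)).
  move=> n m e; case: (ltngtP n m) => // /mono; by rewrite e ltnn.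
apply: infinite_nat; rewrite (_ : setT = (fun n => iter n f x) @^-1` A).
  by apply: finite_preimage finA => n m _ _; apply: inj.
by rewrite eqEsubset; split=> // n _; apply: Ai.
Qed.

Section Escape.
Variable v : K -> int.
Hypotheses (v2 : v 2%:R = 2)
  (vM : forall x y, x != 0 -> y != 0 -> v (x * y) = v x + v y)
  (vD : forall x y, x != 0 -> y != 0 -> x + y != 0 -> v x <= v y -> v x <= v (x + y)).

Let v1 : v 1 = 0.
Proof. by have := vM (oner_neq0 K) (oner_neq0 K); rewrite mulr1; move: (v 1) => c h; lia. Qed.

Let vN x : x != 0 -> v (- x) = v x.
Proof.
move=> nx; have n1 : - 1 != 0 :> K by rewrite oppr_eq0 oner_eq0.
have := vM n1 n1; rewrite mulrNN mulr1 v1 => h.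
by rewrite -mulN1r vM //; lia.
Qed.

Let vX x n : x != 0 -> v (x ^+ n) = n%:Z * v x.
Proof.
move=> nx; elim: n => [|n IH]; first by rewrite expr0 v1 mul0r.
by rewrite exprS vM ?expf_neq0 // IH; lia.
Qed.

Let vV x : x != 0 -> v x^-1 = - v x.
Proof.
move=> nx; have nx' : x^-1 != 0 by rewrite invr_eq0.
by have := vM nx nx'; rewrite mulfV // v1; lia.
Qed.

Let vlt x y : x != 0 -> y != 0 -> x + y != 0 -> v x < v y -> v (x + y) = v x.
Proof.
move=> nx ny nxy lt; have le1 := vD nx ny nxy (ltW lt).
have nny : - y != 0 by rewrite oppr_eq0.
have [le|gt] := leP (v (x + y)) (v (- y)).
  have := vD nxy nny; rewrite addrK => /(_ nx le); lia.
have := vD nny nxy; rewrite addrC addrK => /(_ nx (ltW gt)); rewrite vN //; lia.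
Qed.

Let v8 : v 8%:R = 6.
Proof. by rewrite (natrX _ 2 3) vX ?natK // v2. Qed.

Let v4 : v 4%:R = 4.
Proof. by rewrite (natrX _ 2 2) vX ?natK // v2. Qed.

Definition escaping X := (v X < 0) || (3 <= v X).

Let v_dbl X : noncuspidal X ->
  v (dbl X) = v X + v (X ^+ 3 - 8%:R) - 4 - v (X ^+ 3 + 1).
Proof.
move=> [Y [_ nX nX1 nX8]].
have nX8' : X ^+ 3 - 8%:R != 0 by rewrite subr_eq0.
have nX1' : X ^+ 3 + 1 != 0 by rewrite addr_eq0.
by rewrite /dbl vM ?vV ?vM ?mulf_neq0 ?invr_eq0 ?mulf_neq0 ?natK // v4; ring.
Qed.

(* The valuation jumps -4 downwards from a negative value, +2 upwards from a value
   at least 3, and the values 0, 1, 2 are transient. *)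
Let v_dbl_cases X : noncuspidal X ->
  v X < 0 /\ v (dbl X) = v X - 4 \/ v X = 0 /\ v (dbl X) <= - 4 \/
  v X = 1 /\ v (dbl X) = 0 \/ v X = 2 /\ 4 <= v (dbl X) \/
  3 <= v X /\ v (dbl X) = v X + 2.
Proof.
move=> ncX; rewrite v_dbl //; case: ncX => Y [_ nX nX1 nX8].
have nX3 : X ^+ 3 != 0 by rewrite expf_neq0.
have nX8' : X ^+ 3 + - 8%:R != 0 by rewrite subr_eq0.
have nX1' : X ^+ 3 + 1 != 0 by rewrite addr_eq0.
have n8 : - 8%:R != 0 :> K by rewrite oppr_eq0 natK.
have n1 : 1 != 0 :> K := oner_neq0 K.
have e3 : v (X ^+ 3) = 3 * v X by rewrite vX.
have e8 : v (- 8%:R) = 6 by rewrite vN ?natK.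
have lt8 := vlt nX3 n8 nX8'; have lt1 := vlt nX3 n1 nX1'.
have e1X : 1 + X ^+ 3 = X ^+ 3 + 1 by rewrite addrC.
have e8X : - 8%:R + X ^+ 3 = X ^+ 3 + - 8%:R by rewrite addrC.
have le1 := vD n1 nX3; have gt1 := vlt n1 nX3; rewrite e1X v1 e3 in le1 gt1.
have le8 := vD n8 nX3; have gt8 := vlt n8 nX3; rewrite e8X e8 e3 in le8 gt8.
move: (lt8) (lt1) (le1 nX1') (gt1 nX1') (le8 nX8') (gt8 nX8'); rewrite e3 e8 v1.
move: (v X) (v (_ - _)) (v (_ + 1)) => a b c; clear; lia.
Qed.

Lemma escaping_dbl (X : K) : noncuspidal X -> escaping X ->
  escaping (dbl X) /\ (`|v X| < `|v (dbl X)|)%N.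
Proof.
by move=> /v_dbl_cases; rewrite /escaping; move: (v X) (v (dbl X)) => a b; clear; lia.
Qed.

(** The value 1 goes to 0, 0 goes to at most [- 4], and 2 goes to at least 4, so two duplications
    suffice. *)
Lemma exists_escaping (X : K) : noncuspidal X -> exists Z : K, noncuspidal Z /\ escaping Z.
Proof.
move=> nX; have n1 := noncuspidal_dbl nX; have n2 := noncuspidal_dbl n1.
have [e|e] := boolP (escaping X); first by exists X.
have [e1|e1] := boolP (escaping (dbl X)); first by exists (dbl X).
exists (dbl (dbl X)); split=> //.
move: (v_dbl_cases nX) (v_dbl_cases n1) e e1; rewrite /escaping.
by move: (v X) (v (dbl X)) (v (dbl (dbl X))) => a b c; clear; lia.
Qed.
End Escape.

Theorem infinite_noncuspidal (X : K) : noncuspidal X ->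
  infinite_set [set X : K | noncuspidal X].
Proof.
have [v [v2 vM vD]] := valuation_above_2 d4 er.
move=> /(exists_escaping v2 vM vD) [Z [nZ eZ]].
apply: (@sub_infinite_set _ [set X | noncuspidal X /\ escaping v X]).
  by move=> ? [].
apply: (@infinite_orbit _ _ dbl (fun X => `|v X|%N) Z) => // X' [nX' eX'].
have [e lt] := escaping_dbl v2 vM vD nX' eX'.
by split=> //; split=> //; apply: noncuspidal_dbl.
Qed.
End Orbit.

Local Open Scope classical_set_scope.

Theorem theorem20 (K : fieldExtType rat) (Kbar : closedFieldType)
    (iota : {rmorphism K -> Kbar}) :
  \dim {: K} = 4%N ->
  is_algebraic_closure iota ->
  ~ (geom_classes ('Z_6 * 'Z_6)%type iota !=set0 /\
     finite_set (geom_classes ('Z_6 * 'Z_6)%type iota)).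
Proof.
move=> d4 _ [[_ [E embE _]] fin].
have n2 : 2%:R != 0 :> K := fieldext_rat_natS_neq0 K 1.
have n3 : 3%:R != 0 :> K := fieldext_rat_natS_neq0 K 2.
have [r [X [Y [er eY nX nX1 nX8]]]] := modular_point_of_embedding n2 n3 embE.
have ew : ((r - 1) / 2%:R) ^+ 2 + (r - 1) / 2%:R + 1 = 0.
  transitivity ((r ^+ 2 + 3%:R) / 4%:R).
    by field; rewrite n2 (fieldext_rat_natS_neq0 K 3).
  by rewrite er addNr mul0r.
have ncX : noncuspidal X by exists Y.
exact: (infinite_geom_classes n2 n3 ew (infinite_noncuspidal d4 er ncX) fin).
Qed.
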